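(* Let $R=k[x_0,\ldots,x_n]$ be a polynomial ring over a field $k$ of any characteristic, let $1\le c<s$ be integers, and let $\mathcal F=\{F_1,\ldots,F_s\}$ be a set of $s$ forms in $R$ such that any $c+1$ of them form a regular sequence. Let $I_c=\bigcap_{1\le j_1<\cdots<j_c\le s}(F_{j_1},\ldots,F_{j_c})$. Then: (1) $\mu(I_c^{(2)})=\binom{s+1}{c-1}$ and $\mathrm{sdefect}(I_c,2)=\binom{s}{c-2}$. (2) $\mu(I_c^{(3)})=\binom{s}{c-1}+(s-c+2)\binom{s}{c-2}+\binom{s}{c-3}$ and $\mathrm{sdefect}(I_c,3)=(s-c+2)\binom{s}{c-2}+\binom{s}{c-3}$. (3) $\mu(I_c^{(4)})=\binom{s}{c-1}+\binom{s}{c-2}(s-c+3)+\binom{s}{c-3}\binom{s-c+3}{2}+\binom{s}{c-4}$ and $\mathrm{sdefect}(I_c,4)=\binom{s}{c-2}(s-c+3)+\binom{s}{c-3}\binom{s-c+3}{2}+\binom{s}{c-4}$.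
   Context: For a homogeneous ideal $I\subseteq R$ and $m\ge1$, $I^{(m)}=\bigcap_{P\in \mathrm{Ass}(R/I)}(I^mR_P\cap R)$. $\mu(U)$ is the minimal number of generators of a finitely generated graded $R$-module $U$, and $\mathrm{sdefect}(I,m):=\mu(I^{(m)}/I^m)$. Convention: if $a$ is a negative integer then $\binom ta=0$ for every integer $t$. *)

(* Defs.v *)
From HB Require Import structures.
From mathcomp Require Import all_boot all_order all_algebra.
From mathcomp Require Import mpoly.
From mathcomp Require Import boolp classical_sets.

Set Implicit Arguments.
Unset Strict Implicit.
Unset Printing Implicit Defensive.

Import GRing.Theory.

Local Open Scope classical_set_scope.
Local Open Scope ring_scope.

(* Ideals of a ring R are represented as classical sets of type [set R]. *)

Section Ideals.
Variable R : comNzRingType.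
Implicit Types (S I A B P : set R).

Definition ideal_gen S : set R :=
  [set f : R | exists (r : nat) (a g : 'I_r -> R),
    (forall i, S (g i)) /\ f = \sum_(i < r) a i * g i].

Definition ideal_pow I (m : nat) : set R :=
  ideal_gen [set f : R | exists x : 'I_m -> R,
    (forall i, I (x i)) /\ f = \prod_(i < m) x i].

(* [idealr_closed] includes properness. *)
Definition is_prime_ideal P : Prop :=
  idealr_closed (mem P) /\ prime_idealr_closed (mem P).

(* Ass(R/I): the prime ideals that are annihilators of the class in R/I of
   some x in R. *)
Definition Ass I : set (set R) :=
  [set P : set R | is_prime_ideal P /\ exists x : R, P = [set f : R | I (f * x)]].

Definition regular_seq (r : nat) (f : 'I_r -> R) : Prop :=
  (forall (i : 'I_r) (g : R),
     let J := ideal_gen (f @` [set j : 'I_r | (j < i)%N]) in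
     J (g * f i) -> J g)
  /\ ~ ideal_gen (range f) 1.

(* The classes of the g i generate the R-module A/B. *)
Definition generates A B (r : nat) (g : 'I_r -> R) : Prop :=
  (forall i, A (g i)) /\
  (forall f, A f -> exists a : 'I_r -> R, B (f - \sum_(i < r) a i * g i)).

(* mu(A/B) = r, for ideals B contained in A. *)
Definition mu_quot_is A B (r : nat) : Prop :=
  (exists g : 'I_r -> R, generates A B g) /\
  (forall (r' : nat) (g : 'I_r' -> R), generates A B g -> (r <= r')%N).

Definition mu_is A (r : nat) : Prop := mu_quot_is A [set 0] r.

End Ideals.

Section SymbolicPowers.
Variable R : idomainType.
Implicit Types (I J P : set R).

(* The localization R_P, as a subring of the fraction field of R. *)
Definition localization P : set {fraction R} :=
  [set z | exists a b : R, ~ P b /\ z = tofrac a / tofrac b].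

(* The extended ideal J R_P. *)
Definition extension P J : set {fraction R} :=
  [set z | exists (r : nat) (z_ : 'I_r -> {fraction R}) (g : 'I_r -> R),
    [/\ forall i, localization P (z_ i), forall i, J (g i)
      & z = \sum_(i < r) z_ i * tofrac (g i)]].

Definition contraction P J : set R := @tofrac R @^-1` extension P J.

Definition symbolic_pow I (m : nat) : set R :=
  \bigcap_(P in Ass I) contraction P (ideal_pow I m).

Definition sdefect_is I (m r : nat) : Prop :=
  mu_quot_is (symbolic_pow I m) (ideal_pow I m) r.

(* The intersection of the ideals generated by c of the s elements F i. *)
Definition star_ideal (s c : nat) (F : 'I_s -> R) : set R :=
  \bigcap_(A in [set A : {set 'I_s} | #|A| = c]) ideal_gen (F @` [set` A]).

End SymbolicPowers.

(* Binomial coefficient with an integer lower index, 0 when it is negative;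
   unlike 'C(t, c - 2), this does not truncate c - 2 at 0. *)
Definition binz (t : nat) (a : int) : nat :=
  match a with Posz b => 'C(t, b) | Negz _ => 0%N end.

(* Main.v *)
Require Import Defs.
From HB Require Import structures.
From mathcomp Require Import all_boot all_order all_algebra.
From mathcomp Require Import mpoly.
From mathcomp Require Import boolp classical_sets.
From mathcomp Require Import zify.

(** For a set A of c indices write (F_A) for the ideal of the F_i with i in A, and
    for an exponent a let F^a be the product of the F_i^(a_i).  The whole argument
    takes place between such monomials, although the F_i may be algebraically
    dependent.  Two consequences of the regularity hypothesis replace independence:
    F_A is quasi-regular, that is, a form in F_A of degree j with value in
    (F_A)^(j+1) has coefficients in (F_A) ([quasi_regularU1],
    [regular_quasi_regular]), and F_i is a nonzerodivisor modulo (F_A) for i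
    outside A ([regular_nonzerodiv]).

    The symbolic power I^(m) is the intersection of the (F_A)^m
    ([symbolic_pow_star]).  One inclusion localizes at an associated prime, which
    avoids all F_j with j outside some A; the other needs the associated primes of
    R/(F_A), which exist because R is noetherian.  This intersection is spanned by
    the monomials F^a with the c smallest entries of a having sum at least m
    ([intersection_span]): the components are intersected one at a time, raising
    the power of (F_A) from j to j + 1, in an order for which the monomials with a
    given A-part of degree j are multiples of a single monomial still present
    ([corner_le], [corner_stage], [stage_step]).  It is a shelling argument.

    The minimal exponents a therefore give generators, and they are minimal
    generators because in any relation between monomials of I^(m) the coefficient
    of F^a has no constant term ([minimal_coef]): restricted to the set B of the c
    smallest entries, F^a has degree exactly m, every other term with the same
    B-part is a proper multiple of F^a, and quasi-regularity applies.  The minimal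
    generators lying in I^m are the m-th powers of generators of I
    ([minimal_pow]), so mu(I^(m)) counts all minimal exponents and sdefect(I, m)
    those whose entries are all less than m ([star_mu]).

    An exponent is minimal when its levels, the sets of indices with entry at most
    u, have sizes c - d_u with d a partition of m, or are full once d_u = 0
    ([minimal_levels]).  For m at most 4 this leaves exponents whose entries are
    0, 1 and one further value, which binomial coefficients count
    ([small_minimal_shape], [small_mu]). *)

Set Implicit Arguments.
Unset Strict Implicit.
Unset Printing Implicit Defensive.

Import Order.TTheory GRing.Theory.

(** * Ideals and ordinary powers *)

Section Ideals.
Local Open Scope classical_set_scope.
Local Open Scope ring_scope.
Variable R : comNzRingType.

Definition is_ideal (K : set R) :=
  [/\ K 0, forall x y, K x -> K y -> K (x + y) & forall r x, K x -> K (r * x)].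

Lemma is_ideal_sum (K : set R) (I : eqType) (t : seq I) (P : pred I)
    (f : I -> R) :
  is_ideal K -> (forall i, i \in t -> P i -> K (f i)) ->
  K (\sum_(i <- t | P i) f i).
Proof.
move=> [K0 KD _] Kf; rewrite big_seq_cond.
by elim/big_ind: _ => // i /andP[]; apply: Kf.
Qed.

Lemma is_idealB (K : set R) x y : is_ideal K -> K x -> K y -> K (x - y).
Proof. by move=> [_ KD KM] Kx Ky; rewrite -mulN1r; apply/KD/KM. Qed.

Lemma ideal_gen_ideal (S : set R) : is_ideal (ideal_gen S).
Proof.
split.
- by exists 0%N, (fun _ => 0), (fun _ => 0); split; [case|rewrite big_ord0].
- move=> _ _ [r [a [g [Sg ->]]]] [r' [a' [g' [Sg' ->]]]].
  exists (r + r')%N,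
    (fun i => match fintype.split i with inl j => a j | inr j => a' j end),
    (fun i => match fintype.split i with inl j => g j | inr j => g' j end).
  split=> [i|]; first by case: fintype.splitP.
  rewrite big_split_ord; congr (_ + _); apply: eq_bigr => i _.
    by rewrite (unsplitK (inl i)).
  by rewrite (unsplitK (inr i)).
- move=> c _ [r [a [g [Sg ->]]]]; exists r, (fun i => c * a i), g; split=> //.
  by rewrite mulr_sumr; apply: eq_bigr => i _; rewrite mulrA.
Qed.

Lemma sub_ideal_gen (S : set R) f : S f -> ideal_gen S f.
Proof.
move=> Sf; exists 1%N, (fun _ => 1), (fun _ => f).
by rewrite big_ord1 mul1r.
Qed.

Lemma ideal_gen_min (S K : set R) :
  is_ideal K -> S `<=` K -> ideal_gen S `<=` K.
Proof.
move=> idK SK _ [r [a [g [Sg ->]]]]; apply: (is_ideal_sum idK) => i _ _.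
by case: idK => _ _; apply; apply: SK.
Qed.

Lemma ideal_pow_ideal (I : set R) m : is_ideal (ideal_pow I m).
Proof. exact: ideal_gen_ideal. Qed.

(** The generators of I^(m+1) are products indexed by ordinals, so the new factor
    is put in front of a given product of m factors. *)
Lemma ideal_pow_mul (I : set R) m f g :
  I f -> ideal_pow I m g -> ideal_pow I m.+1 (f * g).
Proof.
move=> If [r [a [h [Ph ->]]]]; rewrite mulr_sumr.
have idP := ideal_pow_ideal I m.+1.
apply: (is_ideal_sum idP) => i _ _; rewrite mulrCA.
case: (idP) => _ _; apply; apply: sub_ideal_gen.
have [x [Ix ->]] := Ph i.
exists (fun i => oapp x f (unlift ord0 i)); split=> [j|].
  by case: (unlift ord0 j) => [l|] //=.
by rewrite big_ord_recl unlift_none; congr (_ * _); apply: eq_bigr => j _;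
  rewrite liftK.
Qed.

End Ideals.

(** * Ideals spanned by monomials in the F_i, and quasi-regularity *)

Section Monomials.
Local Open Scope classical_set_scope.
Local Open Scope ring_scope.
Variables (R : comNzRingType) (s : nat) (F : 'I_s -> R).
Implicit Types (A B : {set 'I_s}) (a b e : 'X_{1..s}) (E : set 'X_{1..s}).
Implicit Types (t u v : seq (R * 'X_{1..s})) (f h : R) (g : 'X_{1..s}).

Definition fmon a : R := \prod_i F i ^+ a i.
Definition wt A a : nat := (\sum_(i in A) a i)%N.

Lemma fmonD a b : fmon (a + b)%MM = fmon a * fmon b.
Proof.
by rewrite /fmon -big_split; apply: eq_bigr => i _; rewrite mnmDE exprD.
Qed.

Lemma fmon0 : fmon 0%MM = 1.
Proof. by rewrite /fmon big1 // => i _; rewrite mnm0E. Qed.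

Lemma fmonU i : fmon U_(i)%MM = F i.
Proof.
rewrite /fmon (bigD1 i) //= mnm1E eqxx expr1 big1 ?mulr1 // => j ji.
by rewrite mnm1E eq_sym (negPf ji).
Qed.

Lemma wtD A a b : wt A (a + b)%MM = (wt A a + wt A b)%N.
Proof. by rewrite /wt -big_split; apply: eq_bigr => i _; rewrite mnmDE. Qed.

Lemma wt0 A : wt A 0%MM = 0%N.
Proof. by rewrite /wt big1 // => i _; rewrite mnm0E. Qed.

Lemma wtU A i : wt A U_(i)%MM = (i \in A).
Proof.
rewrite /wt; have [iA|iA] := boolP (i \in A).
  rewrite (bigD1 i) //= mnm1E eqxx big1 // => j /andP[_ ji].
  by rewrite mnm1E eq_sym (negPf ji).
by rewrite big1 // => j jA; rewrite mnm1E; case: eqP => // ij; rewrite ij jA in iA.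
Qed.

Lemma leq_wt A a b : (a <= b)%MM -> (wt A a <= wt A b)%N.
Proof. by move=> /mnm_lepP ab; apply: leq_sum. Qed.

Lemma mnm1_le a i : (0 < a i)%N -> (U_(i) <= a)%MM.
Proof. by move=> ai; apply/mnm_lepP => l; rewrite mnm1E; case: eqP => // <-. Qed.

Lemma wt_gt0 A a : (0 < wt A a)%N -> exists2 i, i \in A & (0 < a i)%N.
Proof.
rewrite lt0n sum_nat_eq0 => /forallPn[i]; rewrite negb_imply -lt0n => /andP[iA ai].
by exists i.
Qed.

(** Lists of terms (coefficient, exponent) play the role of polynomials in
    formal variables; [fsum] substitutes the F_i, and [coef] collects the
    coefficients of a repeated exponent. *)
Definition fsum t : R := \sum_(x <- t) x.1 * fmon x.2.
Definition coef t g : R := \sum_(x <- t | x.2 == g) x.1.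

Definition span E : set R :=
  [set f | exists t, (forall x, x \in t -> E x.2) /\ f = fsum t].

Lemma span_ideal E : is_ideal (span E).
Proof.
split.
- by exists [::]; rewrite /fsum big_nil.
- move=> _ _ [t [Et ->]] [u [Eu ->]]; exists (t ++ u); split.
    by move=> x; rewrite mem_cat => /orP[/Et|/Eu].
  by rewrite /fsum big_cat.
- move=> r _ [t [Et ->]]; exists [seq (r * x.1, x.2) | x <- t]; split.
    by move=> _ /mapP[x xt ->]; exact: (Et x xt).
  by rewrite /fsum mulr_sumr big_map; apply: eq_bigr => x _; rewrite mulrA.
Qed.

Lemma span_mon E a : E a -> span E (fmon a).
Proof.
move=> Ea; exists [:: (1, a)]; split=> [x|]; first by rewrite inE => /eqP->.
by rewrite /fsum big_seq1 mul1r.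
Qed.

Lemma span_monr E a r : E a -> span E (r * fmon a).
Proof. by case: (span_ideal E) => _ _ M /span_mon; apply: M. Qed.

Lemma span_min E (K : set R) :
  is_ideal K -> (forall a, E a -> K (fmon a)) -> span E `<=` K.
Proof.
move=> idK EK _ [t [Et ->]]; apply: (is_ideal_sum idK) => x xt _.
by case: idK => _ _; apply; apply/EK/Et.
Qed.

Lemma sub_span E E' : E `<=` E' -> span E `<=` span E'.
Proof. by move=> EE'; apply: (span_min (span_ideal _)) => a /EE'; apply: span_mon. Qed.

Lemma span_mul E1 E2 E f h :
  (forall a b, E1 a -> E2 b -> E (a + b)%MM) -> span E1 f -> span E2 h ->
  span E (f * h).
Proof.
move=> E12 [t [Et ->]] [u [Eu ->]]; rewrite /fsum mulr_suml.
apply: (is_ideal_sum (span_ideal E)) => x xt _; rewrite mulr_sumr.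
apply: (is_ideal_sum (span_ideal E)) => y yu _.
rewrite mulrACA -fmonD; apply: span_monr; apply: E12; [exact: Et|exact: Eu].
Qed.

(** This is (F_A)^j; the monomials may involve variables outside A, so that no
    separate module of coefficients is needed. *)
Definition pw A j : set R := span [set a | (j <= wt A a)%N].

Lemma pw_ideal A j : is_ideal (pw A j). Proof. exact: span_ideal. Qed.

Lemma pwM A j r f : pw A j f -> pw A j (r * f).
Proof. by case: (pw_ideal A j) => _ _; apply. Qed.

Lemma pwD A j f h : pw A j f -> pw A j h -> pw A j (f + h).
Proof. by case: (pw_ideal A j) => _ + _; apply. Qed.

Lemma pw_leq A i j : (i <= j)%N -> pw A j `<=` pw A i.
Proof. by move=> ij; apply: sub_span => a /=; apply: leq_trans. Qed.

Lemma pw_mul A i j f h : pw A i f -> pw A j h -> pw A (i + j) (f * h).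
Proof. by apply: span_mul => a b /= ia jb; rewrite wtD leq_add. Qed.

Lemma pw0 A f : pw A 0 f.
Proof. by rewrite -[f]mulr1 -fmon0; apply: span_monr => /=. Qed.

Lemma pw_set A j i f : i \in A -> pw A j f -> pw A j.+1 (F i * f).
Proof.
move=> iA; apply: (@pw_mul _ 1%N); rewrite -fmonU; apply: span_mon => /=.
by rewrite wtU iA.
Qed.

Lemma pw_subset A B j : A \subset B -> pw A j `<=` pw B j.
Proof.
move=> /fintype.subsetP AB; apply: sub_span => a /= ja; apply: leq_trans ja _.
rewrite /wt [leqRHS](bigID (mem A)) /=; apply: leq_trans (leq_addr _ _).
rewrite [leqRHS](eq_bigl (mem A)) // => i /=.
by apply/andP/idP => [[]//|iA]; split=> //; apply: AB.
Qed.

Lemma ideal_gen_pw A : ideal_gen (F @` [set` A]) = pw A 1.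
Proof.
apply/seteqP; split.
  apply: (ideal_gen_min (pw_ideal A 1)) => _ /= [i iA <-].
  by rewrite -[F i]mulr1; apply: pw_set => //; apply: pw0.
apply: (span_min (ideal_gen_ideal _)) => a /=.
move=> /wt_gt0[i iA ai].
rewrite /fmon (bigD1 i) //= -(prednK ai) exprS -mulrA mulrC.
case: (ideal_gen_ideal (F @` [set` A])) => _ _; apply.
by apply: sub_ideal_gen; exists i.
Qed.

(** The exponents of the monomials of degree j in the variables of A alone:
    equality of the A-degree and the total degree excludes the others. *)
Definition formexp A j a := (wt A a == j) && (mdeg a == j).

Lemma formexpD A i j a b : formexp A i a -> formexp A j b -> formexp A (i + j) (a + b)%MM.
Proof.
by rewrite /formexp wtD mdegD => /andP[/eqP-> /eqP->] /andP[/eqP-> /eqP->]; rewrite !eqxx.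
Qed.

Lemma formexp_out A j a i : formexp A j a -> i \notin A -> a i = 0%N.
Proof.
move=> /andP[/eqP wa /eqP]; rewrite mdegE (bigID (mem A)) /= -/(wt A a) wa.
rewrite -[X in _ = X -> _]addn0 => /addnI /eqP; rewrite sum_nat_eq0.
by move=> /forallP/(_ i) /implyP h /h /eqP.
Qed.

Lemma formexp_supp A j a :
  (forall i, i \notin A -> a i = 0%N) -> wt A a = j -> formexp A j a.
Proof.
move=> a0 wa; rewrite /formexp wa eqxx mdegE (bigID (mem A)) /= -/(wt A a) wa.
by rewrite big1 ?addn0 ?eqxx.
Qed.

Definition res A a : 'X_{1..s} := [multinom if i \in A then a i else 0%N | i < s].

Lemma resE A a i : res A a i = if i \in A then a i else 0%N.
Proof. by rewrite mnmE. Qed.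

Lemma res_le A a : (res A a <= a)%MM.
Proof. by apply/mnm_lepP => i; rewrite resE; case: ifP. Qed.

Lemma wt_res A a : wt A (res A a) = wt A a.
Proof. by apply: eq_bigr => i iA; rewrite resE iA. Qed.

Lemma formexp_res A a : formexp A (wt A a) (res A a).
Proof.
by apply: formexp_supp => [i iA|]; [rewrite resE (negPf iA)|rewrite wt_res].
Qed.

Lemma formexp_below A j a : (j <= wt A a)%N -> exists2 b, (b <= a)%MM & formexp A j b.
Proof.
elim: j => [_|j IH ja].
  exists 0%MM; first by apply/mnm_lepP => i; rewrite mnm0E.
  by rewrite /formexp wt0 mdeg0.
have [b ba hb] := IH (ltnW ja).
have [i iA bai] : exists2 i, i \in A & (b i < a i)%N.
  apply/exists_inP; apply: contraLR ja => /exists_inPn h.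
  case/andP: (hb) => /eqP<- _; rewrite -leqNgt; apply: leq_sum => i iA.
  by rewrite leqNgt h.
exists (b + U_(i))%MM.
  apply/mnm_lepP => l; rewrite mnmDE mnm1E; case: eqP => [<-|_]; first by rewrite addn1.
  by rewrite addn0; apply: (mnm_lepP ba).
by rewrite -addn1; apply: formexpD => //; rewrite /formexp wtU iA mdeg1.
Qed.

Lemma pw_homog A j f : pw A j f ->
  exists t, (forall x, x \in t -> formexp A j x.2) /\ f = fsum t.
Proof.
pose K : set R := span [set a | formexp A j a].
suff sub : pw A j `<=` K by move=> /sub; apply.
apply: (span_min (span_ideal _)) => a /= /formexp_below[b ba hb].
by rewrite -(submK ba) fmonD; apply: span_monr.
Qed.

Lemma fsum_cat t u : fsum (t ++ u) = fsum t + fsum u.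
Proof. exact: big_cat. Qed.

Lemma coef_cat t u g : coef (t ++ u) g = coef t g + coef u g.
Proof. exact: big_cat. Qed.

Definition scale r t := [seq (r * x.1, x.2) | x <- t].

Lemma fsum_scale r t : fsum (scale r t) = r * fsum t.
Proof.
by rewrite /fsum big_map mulr_sumr; apply: eq_bigr => x _; rewrite mulrA.
Qed.

Lemma coef_scale r t g : coef (scale r t) g = r * coef t g.
Proof. by rewrite /coef big_map mulr_sumr. Qed.

Lemma scale_exp r t (P : 'X_{1..s} -> Prop) :
  (forall x, x \in t -> P x.2) -> forall x, x \in scale r t -> P x.2.
Proof. by move=> h _ /mapP[x xt ->]; exact: (h x xt). Qed.

Lemma sum_by_key (K : eqType) (X : eqType) (t : seq X) (key : X -> K) (f : X -> R) :
  \sum_(x <- t) f x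
  = \sum_(g <- undup (map key t)) \sum_(x <- t | key x == g) f x.
Proof.
rewrite (exchange_big_dep xpredT) //= big_seq [RHS]big_seq.
apply: eq_bigr => x xt.
rewrite big_mkcond (bigD1_seq (key x)) ?undup_uniq ?mem_undup ?map_f //= eqxx.
by rewrite big1 ?addr0 // => g; rewrite eq_sym => /negPf->.
Qed.

Lemma fsum_coef t : fsum t = \sum_(g <- undup (map snd t)) coef t g * fmon g.
Proof.
rewrite /fsum (sum_by_key _ snd); apply: eq_bigr => g _.
by rewrite mulr_suml; apply: eq_bigr => x /eqP->.
Qed.

Lemma coef_const t g : (forall x, x \in t -> x.2 = 0%MM) ->
  coef t g = if g == 0%MM then fsum t else 0.
Proof.
move=> t0; rewrite /coef /fsum; case: eqP => [->|g0].
  rewrite big_seq_cond [RHS]big_seq; apply: eq_big => x.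
    by case xt: (x \in t) => //=; rewrite (t0 x xt) eqxx.
  by move=> /andP[/t0-> _]; rewrite fmon0 mulr1.
by rewrite big1_seq // => x /andP[/eqP xg /t0 x0]; case: g0; rewrite -xg.
Qed.

(** Collect equal exponents: each coefficient in (F_A) adds one to the order. *)
Lemma pw_coef A j t : (forall x, x \in t -> (j <= wt A x.2)%N) ->
  (forall g, pw A 1 (coef t g)) -> pw A j.+1 (fsum t).
Proof.
move=> ht hc; rewrite fsum_coef; apply: (is_ideal_sum (pw_ideal _ _)).
move=> g; rewrite mem_undup => /mapP[x xt ->] _; rewrite -add1n; apply: pw_mul.
  exact: hc.
by apply: span_mon; apply: ht.
Qed.

(** The associated graded ring of (F_A) is a polynomial ring over R/(F_A): a form
    whose value has higher order than its degree has coefficients in (F_A). *)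
Definition quasi_regular A := forall j t,
  (forall x, x \in t -> formexp A j x.2) -> pw A j.+1 (fsum t) ->
  forall g, pw A 1 (coef t g).

Definition nonzerodiv A i := forall r, pw A 1 (r * F i) -> pw A 1 r.

(** By induction on j: if F_i r lies in (F_A)^(j+1), then r is the value of a form
    of degree j, and F_i times this form has coefficients in (F_A) by
    quasi-regularity; cancelling F_i from them raises the order of r. *)
Lemma nonzerodiv_pw A i j r : quasi_regular A -> nonzerodiv A i ->
  pw A j (F i * r) -> pw A j r.
Proof.
move=> qA nA; elim: j r => [|j IH] r hr; first exact: pw0.
have [t [ht er]] := pw_homog (IH _ (pw_leq (leqnSn j) hr)).
rewrite er; apply: pw_coef => [x /ht /andP[/eqP-> _] //|g].
apply: nA; rewrite mulrC -coef_scale; apply: (qA j).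
  exact: (scale_exp (P := fun a => formexp A j a)).
by rewrite fsum_scale -er.
Qed.

Lemma quasi_regular0 : quasi_regular finset.set0.
Proof.
move=> j t ht [u [hu e]] g.
have {u hu}e : fsum t = 0.
  by rewrite e /fsum big1_seq // => x /andP[_ /hu] /=; rewrite /wt big_set0.
have t0 x : x \in t -> x.2 = 0%MM.
  move=> /ht /andP[/eqP]; rewrite /wt big_set0 => <-.
  by rewrite mdeg_eq0 => /eqP.
by rewrite (coef_const _ t0) e if_same; case: (pw_ideal finset.set0 1).
Qed.

Lemma formexp_setU1 A i j a : i \notin A -> formexp (i |: A) j a -> a i = 0%N ->
  formexp A j a.
Proof.
move=> iA h ai; apply: formexp_supp => [l lA|].
  have [->//|li] := eqVneq l i; apply: formexp_out h _.
  by rewrite !inE (negPf li).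
by case/andP: h => /eqP<- _; rewrite /wt big_setU1 //= ai.
Qed.

Lemma formexp_sub_var A i j a : formexp (i |: A) j.+1 a -> (0 < a i)%N ->
  formexp (i |: A) j (a - U_(i))%MM.
Proof.
move=> h ai; have le1 : (U_(i) <= a)%MM by apply: mnm1_le.
move: h; rewrite -{1}(submK le1) /formexp wtD mdegD wtU !inE eqxx /= mdeg1 !addn1.
by rewrite !eqSS.
Qed.

(** A formal sum t is novar i t + Y_i byvar i t, as [fsum_split] expresses. *)
Definition novar (i : 'I_s) t := [seq x : R * 'X_{1..s} <- t | x.2 i == 0%N].
Definition byvar (i : 'I_s) t :=
  [seq (x.1, (x.2 - U_(i))%MM) | x : R * 'X_{1..s} <- t & x.2 i != 0%N].

Lemma fsum_split i t : fsum t = fsum (novar i t) + F i * fsum (byvar i t).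
Proof.
rewrite /fsum (bigID (fun x : R * 'X_{1..s} => x.2 i == 0%N)) /=.
rewrite big_filter; congr (_ + _).
rewrite big_map big_filter mulr_sumr; apply: eq_bigr => x.
rewrite -lt0n => xi; have le1 : (U_(i) <= x.2)%MM by apply: mnm1_le.
by rewrite -{1}(submK le1) fmonD fmonU /= mulrA mulrC.
Qed.

Lemma coef_novar i t g : g i = 0%N -> coef t g = coef (novar i t) g.
Proof.
move=> gi; rewrite /coef big_filter_cond; apply: eq_bigl => x.
by case: eqP => [->|]; rewrite ?gi ?andbF ?eqxx.
Qed.

Lemma coef_byvar i t g : (0 < g i)%N -> coef t g = coef (byvar i t) (g - U_(i))%MM.
Proof.
move=> gi; rewrite /coef big_map big_filter_cond; apply: eq_bigl => x /=.
apply/eqP/andP => [->|[xi /eqP /mnmP e]]; first by rewrite -lt0n gi.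
apply/mnmP => l; have := e l; rewrite !mnmBE mnm1E; case: eqP => [<-|_].
  by move: xi gi; case: (x.2 i) => // p _; case: (g i) => // q _; rewrite !subn1 /= => ->.
by rewrite !subn0.
Qed.

(** Adjoining a nonzerodivisor modulo (F_A) preserves quasi-regularity.  Write
    the form and an expression of its value in (F_A, F_i)^(j+1) as
    t0 + F_i t1 and u0 + F_i u1 with t0, u0 free of the variable i.  Then
    F_i (t1 - u1) lies in (F_A)^j, hence so does t1 - u1 = v; the form t0 + F_i v
    involves only the variables of A and has value u0 in (F_A)^(j+1), which
    controls the coefficients of t0, and t1 is handled by induction on the
    degree. *)
Lemma quasi_regularU1 A i :
  i \notin A -> quasi_regular A -> nonzerodiv A i -> quasi_regular (i |: A).
Proof.
move=> iA qA nA; have sA : A \subset i |: A by rewrite finset.subsetUr.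
have novar_homog j t : (forall x, x \in t -> formexp (i |: A) j x.2) ->
    forall x, x \in novar i t -> formexp A j x.2.
  by move=> h x; rewrite mem_filter => /andP[/eqP xi /h]; move/formexp_setU1; apply.
have byvar_homog j t : (forall x, x \in t -> formexp (i |: A) j.+1 x.2) ->
    forall x, x \in byvar i t -> formexp (i |: A) j x.2.
  move=> h _ /mapP[x + ->] /=; rewrite mem_filter -lt0n => /andP[xi /h hx].
  exact: formexp_sub_var.
have pwh B j t : (forall x, x \in t -> formexp B j x.2) -> pw B j (fsum t).
  by move=> h; exists t; split=> // x /h /andP[/eqP wx _] /=; rewrite wx.
elim=> [|j IH] t ht /pw_homog[u [hu e]] g.
  have := fsum_split i u; rewrite -{}e => e.
  have t0 x : x \in t -> x.2 = 0%MM.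
    by move=> /ht /andP[_]; rewrite mdeg_eq0 => /eqP.
  rewrite (coef_const _ t0); case: ifP => _; last by case: (pw_ideal (i |: A) 1).
  rewrite e; apply: pwD; first by apply/(pw_subset sA)/pwh/novar_homog.
  by apply: pw_set; [rewrite !inE eqxx|exact: pw0].
have et := fsum_split i t; have eu := fsum_split i u.
set t0 := novar i t in et; set t1 := byvar i t in et.
set u0 := novar i u in eu; set u1 := byvar i u in eu.
have ht0 := novar_homog _ _ ht; have hu0 := novar_homog _ _ hu.
have ht1 := byvar_homog _ _ ht; have hu1 := byvar_homog _ _ hu.
have [v [hv ev]] : exists v, (forall x, x \in v -> formexp A j.+1 x.2) /\
    fsum t1 - fsum u1 = fsum v.
  apply: pw_homog; apply: (nonzerodiv_pw (i := i)) => //.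
  rewrite mulrBr; have -> : F i * fsum t1 - F i * fsum u1 = fsum u0 - fsum t0.
    have e' : fsum t0 + F i * fsum t1 = fsum u0 + F i * fsum u1 by rewrite -et -eu.
    by rewrite -[F i * fsum t1](addKr (fsum t0)) e' addrA addrK addrC.
  apply: is_idealB; [exact: pw_ideal| |exact: pwh].
  by apply/(pw_leq (leqnSn j.+1))/pwh.
have t1_in : pw (i |: A) j.+1 (fsum t1).
  rewrite -[fsum t1](subrK (fsum u1)) ev; apply: pwD; last exact: pwh.
  by apply: pw_subset sA _ _; apply: pwh.
have [gi|gi] := posnP (g i); last by rewrite (coef_byvar _ gi); apply: IH t1_in _.
rewrite (coef_novar _ gi).
have : pw A 1 (coef (t0 ++ scale (F i) v) g).
  apply: (qA j.+1).
    move=> x; rewrite mem_cat => /orP[/ht0 //|]; move: x.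
    exact: (scale_exp (P := fun a => formexp A j.+1 a)).
  rewrite fsum_cat fsum_scale -ev mulrBr addrA -et e eu addrK.
  exact: pwh.
rewrite coef_cat coef_scale => /(pw_subset sA) h.
rewrite -[coef _ g](addrK (F i * coef v g)); apply: is_idealB => //.
  exact: pw_ideal.
by apply: pw_set; [rewrite !inE eqxx|exact: pw0].
Qed.

End Monomials.

(** * From regular sequences to quasi-regularity *)

Section RegularSequences.
Local Open Scope classical_set_scope.
Local Open Scope ring_scope.
Variables (R : comNzRingType) (s c : nat) (F : 'I_s -> R).
Hypothesis hcs : (c < s)%N.
Hypothesis hreg : forall j : 'I_c.+1 -> 'I_s, injective j ->
  regular_seq (fun i => F (j i)).

(** List the elements of A, then i, then all others: the first c + 1 of these
    index a regular sequence in which F_i follows the F_j with j in A. *)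
Lemma regular_nonzerodiv (A : {set 'I_s}) i :
  (#|A| <= c)%N -> i \notin A -> nonzerodiv F A i.
Proof.
move=> Ac iA r; pose l := enum A ++ i :: enum (~: (i |: A)).
have sl : size l = s.
  rewrite size_cat /= -!cardE -add1n addnA addn1 -[RHS](card_ord s).
  by rewrite -(cardsC (i |: A)) cardsU1 iA add1n.
have ul : uniq l.
  rewrite cat_uniq /= !enum_uniq !mem_enum !inE eqxx /= andbT.
  rewrite negb_or iA /=; apply/hasPn => x; rewrite !mem_enum !inE negb_or.
  by case/andP.
pose j (k : 'I_c.+1) := nth i l k.
have ltl (k : 'I_c.+1) : (k < size l)%N by rewrite sl (leq_trans (ltn_ord k)).
have jinj : injective j.
  by move=> k k' /eqP; rewrite nth_uniq // => /eqP /val_inj.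
have Ac' : (#|A| < c.+1)%N by [].
have [h _] := hreg jinj.
move: (h (Ordinal Ac') r) => /=.
have -> : j (Ordinal Ac') = i by rewrite /j nth_cat -cardE ltnn subnn.
suff -> : (fun k : 'I_c.+1 => F (j k)) @` [set k : 'I_c.+1 | (k < #|A|)%N]
  = F @` [set` A] by rewrite !ideal_gen_pw.
apply/seteqP; split => y /= [].
  move=> k kA <-; exists (j k) => //.
  by rewrite /j nth_cat -cardE kA -mem_enum mem_nth // -cardE.
move=> x xA <-; have ixA : (index x (enum A) < #|A|)%N.
  by rewrite cardE index_mem mem_enum.
exists (Ordinal (leq_trans ixA (leq_trans Ac (leqnSn c)))) => //=.
by rewrite /j /= nth_cat -cardE ixA nth_index ?mem_enum.
Qed.

Lemma regular_nonunit i : ~ exists r, r * F i = 1.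
Proof.
move=> [r ri]; pose l := i :: enum (~: [set i]%SET).
have sl : size l = s.
  rewrite /= -cardE cardsCs finset.setCK cards1 card_ord subn1.
  by rewrite prednK // (leq_trans _ hcs).
have ul : uniq l by rewrite /= enum_uniq mem_enum !inE eqxx.
have [|_] := @hreg (fun k : 'I_c.+1 => nth i l k).
  by move=> k k' /eqP; rewrite nth_uniq ?sl ?(leq_trans (ltn_ord _)) // => /eqP/val_inj.
case; rewrite -ri; case: (ideal_gen_ideal (range (fun k : 'I_c.+1 => F (nth i l k)))).
by move=> _ _; apply; apply: sub_ideal_gen; exists ord0.
Qed.

Lemma regular_quasi_regular (A : {set 'I_s}) :
  (#|A| <= c)%N -> quasi_regular F A.
Proof.
move: {2}#|A| (erefl #|A|) => n; elim: n A => [|n IH] A cA Ac.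
  by move/eqP: cA; rewrite cards_eq0 => /eqP->; apply: quasi_regular0.
have [i iA] : exists i, i \in A by apply/set0Pn; rewrite -cards_eq0 cA.
have cA' : #|(A :\ i)%SET| = n.
  by apply/eqP; rewrite -eqSS -cA (cardsD1 i A) iA.
have A'c : (#|(A :\ i)%SET| <= c)%N by rewrite cA' ltnW // -cA.
rewrite -(finset.setD1K iA); apply: quasi_regularU1; first by rewrite !inE eqxx.
  exact: IH.
by apply: regular_nonzerodiv => //; rewrite !inE eqxx.
Qed.

End RegularSequences.

(** * Intersections of the powers of the ideals (F_A) *)

Section Star.
Local Open Scope classical_set_scope.
Local Open Scope ring_scope.
Variables (R : comNzRingType) (s c : nat) (F : 'I_s -> R).
Hypothesis c_gt0 : (0 < c)%N.
Hypothesis quasi_reg : forall A : {set 'I_s}, #|A| = c -> quasi_regular F A.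
Hypothesis regular_off : forall (A : {set 'I_s}) i, #|A| = c -> i \notin A ->
  nonzerodiv F A i.
Implicit Types (A B : {set 'I_s}) (a b e g : 'X_{1..s}).

Local Notation pw := (pw F).
Local Notation fmon := (fmon F).
Local Notation span := (span F).

(** Equivalently, the c smallest entries have sum at least m. *)
Definition sym_exp m : set 'X_{1..s} :=
  [set a | forall A, #|A| = c -> (m <= wt A a)%N].

Lemma nonzerodiv_fmon A a r : #|A| = c -> (forall i, i \in A -> a i = 0%N) ->
  pw A 1 (r * fmon a) -> pw A 1 r.
Proof.
move=> cA; move: {2}(mdeg a) (erefl (mdeg a)) => n.
elim: n a r => [|n IH] a r.
  by move=> /eqP; rewrite mdeg_eq0 => /eqP-> _; rewrite fmon0 mulr1.
move=> da a0; have [i ai] : exists i, (0 < a i)%N.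
  have [/existsP //|/existsPn h] := boolP [exists i, (0 < a i)%N].
  move: da; rewrite mdegE big1 // => i _.
  by apply/eqP; rewrite -leqn0 leqNgt h.
have le1 : (U_(i) <= a)%MM by apply: mnm1_le.
rewrite -(submK le1) fmonD fmonU mulrA => /regular_off h.
have iA : i \notin A by apply/negP => /a0; case: (a i) ai.
apply: (IH (a - U_(i))%MM) (h cA iA).
  by apply/eqP; rewrite -eqSS -da -{2}(submK le1) mdegD mdeg1 addn1.
by move=> l lA; rewrite mnmBE a0.
Qed.

(** The components (F_A)^(j+1) are intersected in the order of increasing
    [rank].  Ties are harmless: between two sets of equal rank and size some
    exchange is still strictly decreasing. *)
Definition rank A := (\sum_(i in A) val i)%N.

Definition swap A (i l : 'I_s) : {set 'I_s} := (l |: A :\ i)%SET.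

Lemma card_swap A i l : i \in A -> l \notin A -> #|swap A i l| = #|A|.
Proof.
move=> iA lA; rewrite cardsU1 !inE (negPf lA) andbF add1n.
by rewrite (cardsD1 i A) iA add1n.
Qed.

Lemma sum_swap A i l (f : 'I_s -> nat) : i \in A -> l \notin A ->
  (\sum_(x in swap A i l) f x + f i = \sum_(x in A) f x + f l)%N.
Proof.
move=> iA lA; rewrite big_setU1 /=; last by rewrite !inE (negPf lA) andbF.
by rewrite (big_setD1 i iA) /= [LHS]addnC [LHS]addnCA [LHS]addnC.
Qed.

(** Otherwise every element of A outside B would be smaller than every element of
    B outside A, which are equally many, and B would have larger rank. *)
Lemma rank_exchange A B : #|A| = #|B| -> A != B -> (rank B <= rank A)%N ->
  exists i l, [/\ i \in A, i \notin B, l \in B, l \notin A & (l < i)%N].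
Proof.
move=> cAB AB rAB; apply: contrapT => h.
have {}h i l : i \in (A :\: B)%SET -> l \in (B :\: A)%SET -> (i < l)%N.
  rewrite !inE => /andP[iB iA] /andP[lA lB]; rewrite ltnNge leq_eqVlt.
  apply/negP => /orP[/eqP /val_inj li|li]; first by rewrite li iA in lA.
  by apply: h; exists i, l.
have cD : #|(A :\: B)%SET| = #|(B :\: A)%SET|.
  by apply/eqP; rewrite -(eqn_add2l #|(A :&: B)%SET|) cardsID finset.setIC cardsID cAB.
have [i0 i0AB] : exists i, i \in (A :\: B)%SET.
  apply/set0Pn; apply: contra AB; rewrite -cards_eq0 => /eqP h0.
  rewrite eqEcard cAB leqnn andbT -finset.setD_eq0 -cards_eq0 h0; done.
case: (@arg_maxnP _ i0 (mem (A :\: B)%SET) val i0AB) => M MAB Mmax.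
have : (rank A < rank B)%N; last by rewrite ltnNge rAB.
rewrite /rank (big_setID B) [ltnRHS](big_setID A) /= finset.setIC ltn_add2l.
apply: (@leq_ltn_trans (\sum_(i in (A :\: B)%SET) M)%N).
  by apply: leq_sum => i /Mmax.
rewrite sum_nat_const cD -sum_nat_const.
have [l0 l0BA] : exists l, l \in (B :\: A)%SET.
  by apply/set0Pn; rewrite -cards_eq0 -cD cards_eq0; apply/set0Pn; exists i0.
rewrite (bigD1 l0) //= [ltnRHS](bigD1 l0) //= -addSn leq_add ?(h M) //.
by apply: leq_sum => l /andP[lBA _]; apply/ltnW/h.
Qed.

Definition stage j (D : {set {set 'I_s}}) : set 'X_{1..s} :=
  [set a | forall A, #|A| = c -> (j + (A \in D) <= wt A a)%N].

Section Step.
Variables (j : nat) (A : {set 'I_s}) (D : {set {set 'I_s}}).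
Hypothesis cA : #|A| = c.
Hypothesis AD : A \notin D.
Hypothesis D_rank : forall B, B \in D -> (rank B <= rank A)%N.
Hypothesis D_down : forall B, #|B| = c -> (rank B < rank A)%N -> B \in D.

Definition top g : nat := \max_(i in A) g i.

Lemma top_attained g : exists2 i, i \in A & g i = top g.
Proof.
have A0 : (0 < #|A|)%N by rewrite cA.
by have [i iA e] := eq_bigmax_cond (fun i => g i) A0; exists i.
Qed.

(** The least exponent of stage j D with A-part g, when g has A-weight j.
    Replacing in A an index x of largest exponent by l outside A gives a set B, and
    the condition at B forces the exponent at l to be at least top g, and even
    larger when B has already been met, as happens for l < x. *)
Definition corner g : 'X_{1..s} :=
  [multinom if i \in A then g i else
     (top g + [exists x in A, (g x == top g) && (i < x)%N])%N | i < s].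

Lemma corner_in g i : i \in A -> corner g i = g i.
Proof. by rewrite mnmE => ->. Qed.

Lemma corner_out g i : i \notin A -> corner g i =
  (top g + [exists x in A, (g x == top g) && (i < x)%N])%N.
Proof. by rewrite mnmE => /negPf->. Qed.

Lemma corner_res g : corner (res A g) = corner g.
Proof.
have tg : top (res A g) = top g by apply: eq_bigr => i iA; rewrite resE iA.
apply/mnmP => i; rewrite !mnmE tg; case: ifP => // iA; first by rewrite iA.
congr (_ + nat_of_bool _)%N; apply: eq_existsb => x; case xA: (x \in A) => //=.
by rewrite resE xA.
Qed.

Lemma wt_corner g : wt A (corner g) = wt A g.
Proof. by apply: eq_bigr => i /corner_in->. Qed.

Lemma corner_le a : stage j D a -> wt A a = j -> (corner a <= a)%MM.
Proof.
move=> Da wa; apply/mnm_lepP => l; have [lA|lA] := boolP (l \in A).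
  by rewrite corner_in.
rewrite corner_out //.
have key x : x \in A -> a x = top a -> (top a + (swap A x l \in D) <= a l)%N.
  move=> xA ax; have := Da (swap A x l); rewrite card_swap // => /(_ cA).
  have := sum_swap a xA lA; rewrite -!/(wt _ a) wa ax => e1 e2.
  by rewrite -(leq_add2l j) -e1 addnCA [leqLHS]addnC leq_add2r.
case: existsP => [[x /and3P[xA /eqP ax lx]]|_] /=; last first.
  have [x xA ax] := top_attained a; rewrite addn0.
  by apply: leq_trans (key x xA ax); apply: leq_addr.
have := key x xA ax; rewrite D_down //; first by rewrite card_swap.
by rewrite -(ltn_add2r x) (sum_swap val xA lA) ltn_add2l.
Qed.

(** Replacing elements of A by outside ones cannot lower the weight, because the
    entries outside A are at least top a.  For B already met, one of the exchanged
    pairs is a strict increase by [rank_exchange]. *)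
Lemma corner_stage a : wt A a = j -> stage j D (corner a).
Proof.
move=> wa B cB.
have wB : (wt B (corner a) + wt (A :\: B)%SET a
           = j + wt (B :\: A)%SET (corner a))%N.
  rewrite -wa -wt_corner /wt (big_setID A) [in RHS](big_setID B) /=.
  rewrite [(A :&: B)%SET]finset.setIC -!addnA; congr (_ + _)%N.
  rewrite addnC; congr (_ + _)%N; apply: eq_bigr => i.
  by rewrite !inE => /andP[_ /corner_in].
have cD : #|(A :\: B)%SET| = #|(B :\: A)%SET|.
  by apply/eqP; rewrite -(eqn_add2l #|(A :&: B)%SET|) cardsID finset.setIC cardsID cA cB.
have up : (wt (A :\: B)%SET a <= #|(A :\: B)%SET| * top a)%N.
  rewrite -sum_nat_const; apply: leq_sum => i; rewrite inE => /andP[_ iA].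
  exact: (leq_bigmax_cond (F := fun i => a i)).
have dn : (#|(B :\: A)%SET| * top a <= wt (B :\: A)%SET (corner a))%N.
  rewrite -sum_nat_const; apply: leq_sum => i; rewrite inE => /andP[iA _].
  by rewrite corner_out // leq_addr.
have [BD|BD] := boolP (B \in D); last by rewrite addn0; lia.
have AB : A != B by apply: contraNneq AD => ->.
have [] := @rank_exchange A B _ AB (D_rank BD); first by rewrite cA cB.
move=> i [l [iA iB lB lA li]].
(* An entry below top a at i, or the extra 1 of the corner at l, makes the exchange
   of A for B a strict increase. *)
have [ai|ai] := ltnP (a i) (top a).
  suff : (wt (A :\: B)%SET a < #|(A :\: B)%SET| * top a)%N by lia.
  rewrite -sum_nat_const /wt (bigD1 i) ?inE ?iA ?iB //= [ltnRHS](bigD1 i) ?inE ?iA ?iB //=.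
  rewrite -addSn leq_add //; apply: leq_sum => x; rewrite inE => /andP[/andP[_ xA] _].
  exact: (leq_bigmax_cond (F := fun i => a i)).
suff : (#|(B :\: A)%SET| * top a < wt (B :\: A)%SET (corner a))%N by lia.
rewrite -sum_nat_const /wt (bigD1 l) ?inE ?lA ?lB //= [ltnRHS](bigD1 l) ?inE ?lA ?lB //=.
rewrite -addSn leq_add //.
  rewrite corner_out //; have -> : [exists x in A, (a x == top a) && (l < x)%N].
    apply/existsP; exists i; rewrite iA li andbT eqn_leq ai andbT.
    exact: (leq_bigmax_cond (F := fun i => a i)).
  by rewrite addn1.
apply: leq_sum => x; rewrite inE => /andP[/andP[xA _] _].
by rewrite corner_out // leq_addr.
Qed.


(** Meeting one more component.  The terms of f of A-degree j are multiples of
    corners; grouping them by their A-part g writes f, up to terms already in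
    (F_A)^(j+1), as a form in F_A with coefficients K_g * M_g, where M_g is a
    monomial in the remaining F_i.  Quasi-regularity puts K_g * M_g, hence K_g,
    in (F_A), and (F_A) times a corner is spanned by the next stage. *)
Lemma stage_step f :
  span (stage j D) f -> pw A j.+1 f -> span (stage j (A |: D)%SET) f.
Proof.
move=> [t [ht ef]] fA.
have addA a : stage j D a -> (j < wt A a)%N -> stage j (A |: D)%SET a.
  move=> Da ja B cB; rewrite in_setU1; have [->|BA] := eqVneq B A.
    by rewrite orTb addn1.
  exact: Da.
pose hi := [seq x : R * 'X_{1..s} <- t | (j < wt A x.2)%N].
pose lo := [seq x : R * 'X_{1..s} <- t | ~~ (j < wt A x.2)%N].
have eqf : f = fsum F hi + fsum F lo.
  by rewrite ef /fsum (bigID (fun x => (j < wt A x.2)%N)) /= !big_filter.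
have hi_in : span (stage j (A |: D)%SET) (fsum F hi).
  exists hi; split=> // x; rewrite mem_filter => /andP[jx /ht Dx]; exact: addA.
rewrite eqf; case: (span_ideal F (stage j (A |: D)%SET)) => _ addK _.
apply: addK => //.
have lo_pw : pw A j.+1 (fsum F lo).
  have -> : fsum F lo = f - fsum F hi by rewrite eqf addrC addKr.
  apply: is_idealB => //; first exact: pw_ideal.
  by exists hi; split=> // x; rewrite mem_filter => /andP[].
have lo_in x : x \in lo -> stage j D x.2 /\ wt A x.2 = j.
  rewrite mem_filter -leqNgt => /andP[xj /ht Dx]; split=> //.
  apply/eqP; rewrite eqn_leq xj; have := Dx A cA.
  by rewrite (negPf AD) addn0.
pose cof (x : R * 'X_{1..s}) := x.1 * fmon (x.2 - corner x.2)%MM.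
pose rem a := (corner a - res A a)%MM.
have res_corner a : (res A a <= corner a)%MM.
  apply/mnm_lepP => i; rewrite resE; case: ifP => // iA.
  by rewrite corner_in.
pose forms := [seq (cof x * fmon (rem x.2), res A x.2) | x <- lo].
pose K g := \sum_(x <- lo | res A x.2 == g) cof x.
have e1 : fsum F forms = fsum F lo.
  rewrite /fsum big_map big_seq [RHS]big_seq; apply: eq_bigr => x /lo_in[Dx wx] /=.
  rewrite -mulrA -fmonD submK // /cof -mulrA -fmonD submK //.
  exact: corner_le.
have e2 : fsum F lo = \sum_(g <- undup [seq res A x.2 | x <- lo]) K g * fmon (corner g).
  rewrite /fsum (sum_by_key _ (fun x => res A x.2)); apply: eq_bigr => g _.
  rewrite mulr_suml big_seq_cond [RHS]big_seq_cond.
  apply: eq_bigr => x /andP[/lo_in[Dx wx] /eqP <-].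
  by rewrite corner_res /cof -mulrA -fmonD submK //; apply: corner_le.
have e3 g : coef forms g = K g * fmon (rem g).
  rewrite /coef big_map mulr_suml; apply: eq_bigr => x /= /eqP <-.
  rewrite /rem corner_res; congr (_ * fmon (_ - _)%MM).
  by apply/mnmP => i; rewrite !resE; case: ifP.
have K_in g : g \in [seq res A x.2 | x <- lo] -> pw A 1 (K g).
  move=> glo; apply: (@nonzerodiv_fmon A (rem g)) => //.
    by move=> i iA; rewrite mnmBE resE iA corner_in // subnn.
  rewrite -e3 //; apply: (quasi_reg cA (j := j)); last by rewrite e1.
  move=> _ /mapP[x /lo_in[_ wx] ->] /=; rewrite -wx; exact: formexp_res.
rewrite e2; apply: (is_ideal_sum (span_ideal _ _)) => g.
rewrite mem_undup => glo _.
have [x /lo_in[Dx wx] eg] := mapP glo.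
apply: span_mul (K_in g glo) (span_mon F (erefl (corner g))) => a b /= a1 eb.
rewrite -eb eg corner_res; apply: addA.
  move=> B cB; apply: leq_trans (corner_stage wx cB) _.
  exact: leq_wt (lem_addl _ _).
by rewrite wtD wt_corner wx -add1n leq_add2r.
Qed.

End Step.

(** The element of D of largest rank is met last. *)
Lemma stage_span j f (D : {set {set 'I_s}}) :
  (forall A, A \in D -> #|A| = c) ->
  (forall A B, A \in D -> #|B| = c -> (rank B < rank A)%N -> B \in D) ->
  (forall A, A \in D -> pw A j.+1 f) ->
  span (sym_exp j) f -> span (stage j D) f.
Proof.
move: {2}#|D| (leqnn #|D|) => n; elim: n D => [|n IH] D Dn cD downD fD fj.
  apply: sub_span fj => a aj B cB; have -> : (B \in D) = false.
    by move: Dn; rewrite leqn0 cards_eq0 => /eqP->; rewrite inE.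
  by rewrite addn0; apply: aj.
have [->|/set0Pn[A0 A0D]] := eqVneq D finset.set0.
  by apply: sub_span fj => a aj B cB; rewrite inE addn0; apply: aj.
case: (@arg_maxnP _ A0 (mem D) rank A0D) => A AD Amax.
rewrite -(finset.setD1K AD); apply: stage_step; rewrite ?cD //.
- by rewrite !inE eqxx.
- by move=> B; rewrite !inE => /andP[_ /Amax].
- move=> B cB rB; rewrite !inE (downD A) // andbT.
  by apply: contraTneq rB => ->; rewrite ltnn.
- apply: IH => //.
  + by move: Dn; rewrite (cardsD1 A D) (_ : A \in D).
  + by move=> B; rewrite !inE => /andP[_ /cD].
  + move=> B B'; rewrite !inE => /andP[BA BD] cB' rB'.
    rewrite (downD B) // andbT; apply: contraTneq rB' => ->.
    by rewrite -leqNgt; apply: Amax.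
  + by move=> B; rewrite !inE => /andP[_ /fD].
- exact: fD.
Qed.

(** For the inclusion from left to right, by induction on m, raise the powers of
    all components from j to j + 1, one component at a time. *)
Theorem intersection_span m f :
  (forall A, #|A| = c -> pw A m f) <-> span (sym_exp m) f.
Proof.
split=> [fA|fm A cA]; last by apply: sub_span fm => a; apply.
elim: m fA => [|m IH] fA.
  by rewrite -[f]mulr1 -(fmon0 F); apply: span_monr => A _.
have {}IH : span (sym_exp m) f.
  by apply: IH => A cA; apply: pw_leq (leqnSn m) _ (fA A cA).
have := @stage_span m f [set A : {set 'I_s} | #|A| == c]%SET.
case=> //.
- by move=> A; rewrite inE => /eqP.
- by move=> A B _ cB _; rewrite inE cB.
- by move=> A; rewrite inE => /eqP /fA.
move=> t [ht ->]; exists t; split=> // x /ht Sx A cA.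
by have := Sx A cA; rewrite inE cA eqxx addn1.
Qed.

End Star.

(** * Minimal exponents *)

Section MinimalExponents.
Local Open Scope classical_set_scope.
Variables (s c : nat).
Hypothesis c_gt0 : (0 < c)%N.
Hypothesis lt_cs : (c < s)%N.
Implicit Types (A B : {set 'I_s}) (a b e g : 'X_{1..s}).

Local Notation sym_exp := (@sym_exp s c).

Definition minimal m a :=
  sym_exp m a /\ forall b, sym_exp m b -> (b <= a)%MM -> b = a.

Lemma minimal_below m a : sym_exp m a -> exists2 b, minimal m b & (b <= a)%MM.
Proof.
move: {2}(mdeg a) (leqnn (mdeg a)) => n; elim: n a => [|n IH] a an Sa.
  exists a; last exact: lepm_refl.
  split=> // b _ /mnm_lepP ba; apply/mnmP => i; apply/eqP; rewrite eqn_leq ba.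
  by move: an; rewrite leqn0 mdeg_eq0 => /eqP->; rewrite mnm0E.
have [[b [Sb ba b_neq]]|h] := pselect (exists b, [/\ sym_exp m b, (b <= a)%MM & b <> a]).
  have [|b' mb' b'b] := IH b _ Sb; last by exists b' => //; apply: lepm_trans b'b ba.
  rewrite -ltnS; apply: leq_trans an; rewrite -(submK ba) mdegD -[ltnLHS]add0n.
  rewrite ltn_add2r lt0n mdeg_eq0; apply/eqP => e0.
  by apply: b_neq; rewrite -(submK ba) e0 add0m.
exists a; last exact: lepm_refl.
by split=> // b Sb ba; apply: contrapT => ne; apply: h; exists b.
Qed.

(** B carries the c smallest entries of a. *)
Definition lightest a B :=
  #|B| = c /\ forall A, #|A| = c -> (wt B a <= wt A a)%N.

Lemma lightest_exists a : exists B, lightest a B.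
Proof.
have [A0 cA0] : exists A : {set 'I_s}, #|A| == c.
  have : (0 < #|[set A : {set 'I_s} | #|A| == c]%SET|)%N.
    by rewrite card_draws card_ord bin_gt0 ltnW.
  by case/card_gt0P => A; rewrite inE; exists A.
case: (@arg_minnP _ A0 (fun A => #|A| == c) (fun A => wt A a) cA0) => B /eqP cB minB.
by exists B; split=> // A /eqP; apply: minB.
Qed.

Lemma lightest_le a B i l : lightest a B -> i \in B -> l \notin B -> (a i <= a l)%N.
Proof.
move=> [cB minB] iB lB; rewrite -(leq_add2l (wt B a)) -(sum_swap a iB lB) leq_add2r.
by apply: minB; rewrite card_swap.
Qed.

Lemma top_le B a i : i \in B -> (a i <= top B a)%N.
Proof. exact: (leq_bigmax_cond (F := fun i => a i)). Qed.

Lemma lightest_top a B l : lightest a B -> l \notin B -> (top B a <= a l)%N.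
Proof.
move=> lB lnB; have [i iB <-] := top_attained c_gt0 (proj1 lB) a.
exact: lightest_le lB iB lnB.
Qed.

(** Otherwise every weight exceeds m, and a positive entry of a could be
    lowered. *)
Lemma minimal_wt m a B : (0 < m)%N -> minimal m a -> lightest a B -> wt B a = m.
Proof.
move=> m0 [Sa mina] [cB minB]; apply/eqP; rewrite eqn_leq Sa // andbT leqNgt.
apply/negP => mB; have : (0 < wt B a)%N by apply: leq_trans mB.
move=> /wt_gt0[i iB ai].
have le1 : (U_(i) <= a)%MM by apply: mnm1_le.
have /mnmP/(_ i) : (a - U_(i))%MM = a.
  apply: mina; last exact: lem_subr.
  move=> A cA; have : (m < wt A a)%N by apply: leq_trans mB (minB A cA).
  rewrite -{1}(submK le1) wtD wtU; case: (i \in A) => /=; rewrite ?addn1 ?addn0 //.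
  exact: ltnW.
by rewrite mnmBE mnm1E eqxx; case: (a i) ai => // p _; rewrite subn1 /=; lia.
Qed.

(** A larger entry at l could be lowered: a set of size c containing l has at
    least the weight of a set obtained by exchanging l for an element of B. *)
Lemma minimal_out m a B l : (0 < m)%N -> minimal m a -> lightest a B -> l \notin B ->
  a l = top B a.
Proof.
move=> m0 [Sa mina] lB lnB; apply/eqP; rewrite eqn_leq lightest_top // andbT leqNgt.
apply/negP => gtl; have cB := proj1 lB.
have le1 : (U_(l) <= a)%MM by apply/mnm1_le/(leq_ltn_trans _ gtl).
have al : a l = ((a - U_(l))%MM l).+1.
  by rewrite mnmBE mnm1E eqxx subn1 prednK //; apply: leq_trans gtl.
have anl x : x != l -> (a - U_(l))%MM x = a x.
  by move=> xl; rewrite mnmBE mnm1E eq_sym (negPf xl) subn0.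
have /mnmP/(_ l) : (a - U_(l))%MM = a; last by rewrite al; lia.
apply: mina; last exact: lem_subr.
have Sout A : #|A| = c -> l \notin A -> (m <= wt A (a - U_(l))%MM)%N.
  move=> cA lA; have -> : wt A (a - U_(l))%MM = wt A a; last exact: Sa.
  by apply: eq_bigr => x xA; apply: anl; apply: contraNneq lA => <-.
move=> A cA; have [lA|] := boolP (l \in A); last exact: Sout.
(* Exchange l for an element i of B missing from A: this does not increase the
   weight. *)
have [i iB iA] : exists2 i, i \in B & i \notin A.
  apply/subsetPn; apply: contra lnB => BA.
  by have /eqP -> : B == A by rewrite eqEcard BA cA cB leqnn.
have il : i != l by apply: contraNneq lnB => <-.
have sw : l \notin swap A l i by rewrite !inE eqxx /= orbF eq_sym.
have := Sout (swap A l i); rewrite card_swap // => /(_ cA sw) h.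
apply: leq_trans h _; rewrite -(leq_add2r ((a - U_(l))%MM l)).
rewrite (sum_swap (fun x => (a - U_(l))%MM x) lA iA) leq_add2l anl //.
by rewrite -ltnS -al; apply: leq_ltn_trans (top_le _ iB) gtl.
Qed.

(** The entries of b outside B are at least top B a, by exchanging them for an
    element of B where this value is attained. *)
Lemma minimal_agree m a b B : (0 < m)%N -> minimal m a -> lightest a B ->
  sym_exp m b -> (forall i, i \in B -> b i = a i) -> (a <= b)%MM.
Proof.
move=> m0 mina lB Sb ab; apply/mnm_lepP => l.
have [lB'|lnB] := boolP (l \in B); first by rewrite ab.
rewrite (minimal_out m0 mina lB lnB).
have cB := proj1 lB; have [i iB <-] := top_attained c_gt0 cB a.
have wb : wt B b = m.
  by rewrite -(minimal_wt m0 mina lB); apply: eq_bigr => x xB; rewrite ab.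
rewrite -ab // -(leq_add2l m) -{2}wb -(sum_swap b iB lnB) leq_add2r.
by apply: Sb; rewrite card_swap.
Qed.

Lemma minimal_bound m a i : (0 < m)%N -> minimal m a -> (a i <= m)%N.
Proof.
move=> m0 mina; have [B lB] := lightest_exists a.
have top_m : (top B a <= m)%N.
  have [x xB <-] := top_attained c_gt0 (proj1 lB) a.
  by rewrite -(minimal_wt m0 mina lB) /wt (bigD1 x) //= leq_addr.
apply: leq_trans top_m; have [iB|iB] := boolP (i \in B); first exact: top_le.
by rewrite (minimal_out m0 mina lB iB).
Qed.

(** The exponents of the products of m monomials of sym_exp 1, hence of I^m. *)
Fixpoint pow_exp m : set 'X_{1..s} :=
  if m is n.+1 then
    [set b | exists a b', [/\ sym_exp 1 a, pow_exp n b' & b = (a + b')%MM]]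
  else [set 0%MM].

Lemma pow_sym_exp m : pow_exp m `<=` sym_exp m.
Proof.
elim: m => [|m IH] b; first by move=> _ A _.
move=> [a [b' [Sa /IH Sb ->]]] A cA.
by rewrite wtD -add1n leq_add ?Sa ?Sb.
Qed.

(** Each of the m summands of b has weight exactly 1 on B, so exchanging its
    nonzero entry in B for l shows that it is nonzero at l. *)
Lemma pow_exp_out m b B l : #|B| = c -> pow_exp m b -> wt B b = m -> l \notin B ->
  (m <= b l)%N.
Proof.
move=> cB + + lB; elim: m b => // m IH _ [a [b' [Sa Pb ->]]] wb.
have a1 := Sa B cB; have b1 := pow_sym_exp Pb cB.
have [wa wb'] : wt B a = 1%N /\ wt B b' = m by move: wb; rewrite wtD; lia.
rewrite mnmDE -add1n leq_add ?IH //.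
have : (0 < wt B a)%N by rewrite wa.
move=> /wt_gt0[i iB ai].
apply: leq_trans ai _; rewrite -(leq_add2l 1) -{2}wa -(sum_swap a iB lB) leq_add2r.
by apply: Sa; rewrite card_swap.
Qed.

(** By [pow_exp_out] a minimal exponent of I^m is at least m outside B.  Conversely
    an entry m forces all entries to be 0 or m, since the c smallest have sum m,
    and the exponent is then m times one of sym_exp 1. *)
Lemma minimal_pow m a : (0 < m)%N -> minimal m a ->
  (pow_exp m a <-> exists l, (m <= a l)%N).
Proof.
move=> m0 mina; have [B lB] := lightest_exists a; have cB := proj1 lB.
have wB := minimal_wt m0 mina lB.
split=> [Pa|[l ml]].
  have [l lnB] : exists l, l \notin B.
    have : ~: B != finset.set0.
      by rewrite -card_gt0 cardsCs finset.setCK card_ord cB subn_gt0.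
    by case/set0Pn => l; rewrite inE; exists l.
  by exists l; apply: pow_exp_out wB lnB.
have topm : (m <= top B a)%N.
  have [lB'|lnB] := boolP (l \in B); first exact: leq_trans (top_le _ lB').
  by rewrite -(minimal_out m0 mina lB lnB).
have [i iB ai] := top_attained c_gt0 cB a.
have aim : a i = m by apply/eqP; rewrite eqn_leq minimal_bound //= ai.
have a0 x : x \in B -> x != i -> a x = 0%N.
  move=> xB xi; move: wB; rewrite /wt (bigD1 i) //= aim.
  rewrite -[RHS]addn0 => /addnI /eqP; rewrite sum_nat_eq0 => /forallP/(_ x).
  by rewrite xB xi => /eqP.
have a0m x : a x = 0%N \/ a x = m.
  have [xB|xB] := boolP (x \in B); last first.
    by right; rewrite (minimal_out m0 mina lB xB) -ai.
  by have [->|xi] := eqVneq x i; [right|left; apply: a0].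
pose e : 'X_{1..s} := [multinom nat_of_bool (0 < a x)%N | x < s].
have Se : sym_exp 1 e.
  move=> A cA; have : (0 < wt A a)%N by apply: leq_trans m0 ((proj1 mina) A cA).
  move=> /wt_gt0[x xA ax].
  by rewrite /wt (bigD1 x) //= mnmE ax.
have -> : a = (e *+ m)%MM.
  by apply/mnmP => x; rewrite mulmnE mnmE; case: (a0m x) => -> //; rewrite m0 mul1n.
elim: (m) => [|n IH]; first by rewrite mulm0n.
by exists e, (e *+ n)%MM; split=> //; rewrite mulmS.
Qed.

End MinimalExponents.

(** * Counting generators *)

Section Generators.
Local Open Scope classical_set_scope.
Local Open Scope ring_scope.
Variables (R : comNzRingType) (k : fieldType) (eps : {rmorphism R -> k}).

(** If N elements generate A modulo B and all their relations modulo B have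
    coefficients in the kernel of eps, expressing them through r other generators
    and back factors the identity matrix of size N over k through a space of
    dimension r. *)
Lemma mu_quot_is_basis (A B : set R) N (e : 'I_N -> R) :
  is_ideal B -> (forall i, A (e i)) ->
  (forall f, A f -> exists r : 'I_N -> R, B (f - \sum_i r i * e i)) ->
  (forall r : 'I_N -> R, B (\sum_i r i * e i) -> forall i, eps (r i) = 0) ->
  mu_quot_is A B N.
Proof.
move=> idB Ae gen indep; split; first by exists e; split.
move=> r g [Ag geng].
have /choice[H hH] i : exists a : 'I_r -> R, B (e i - \sum_j a j * g j) by exact: geng.
have /choice[L hL] j : exists a : 'I_N -> R, B (g j - \sum_i a i * e i) by exact: gen.
pose M := (\matrix_(i, j) eps (H i j) : 'M[k]_(N, r)).
pose M' := (\matrix_(j, i) eps (L j i) : 'M[k]_(r, N)).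
suff MM' : 1%:M = M *m M'.
  by rewrite -(mxrank1 k N) MM' (leq_trans (mxrankM_maxl _ _)) // rank_leq_col.
apply/matrixP => i l; rewrite !mxE.
have := indep (fun l => (i == l)%:R - \sum_j H i j * L j l).
rewrite (_ : \sum_i0 _ = (e i - \sum_j H i j * g j)
    + \sum_j H i j * (g j - \sum_l L j l * e l)).
  move=> /(_ _ l); rewrite rmorphB rmorph_nat rmorph_sum /= => h.
  apply/eqP; rewrite -subr_eq0 [X in _ - X](eq_bigr (fun j => eps (H i j * L j l))).
    by apply/eqP/h; case: (idB) => _ BD BM; apply: BD => //;
      apply: (is_ideal_sum idB) => j _ _; apply: BM.
  by move=> j _; rewrite !mxE rmorphM.
transitivity (e i - \sum_l \sum_j H i j * L j l * e l).
  transitivity (\sum_l (i == l)%:R * e l - \sum_l \sum_j H i j * L j l * e l).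
    by rewrite -sumrB; apply: eq_bigr => m _; rewrite mulrBl mulr_suml.
  congr (_ - _); rewrite (bigD1 i) //= eqxx mul1r big1 ?addr0 // => m mi.
  by rewrite eq_sym (negPf mi) mul0r.
rewrite -addrA; congr (_ + _); rewrite exchange_big /=.
rewrite [X in _ = _ + X](eq_bigr (fun j => H i j * g j - \sum_l H i j * L j l * e l)).
  by rewrite sumrB addKr.
move=> j _; rewrite mulrBr mulr_sumr; congr (_ - _).
by apply: eq_bigr => m _; rewrite mulrA.
Qed.

End Generators.

Section StarGenerators.
Local Open Scope classical_set_scope.
Local Open Scope ring_scope.
Variables (R : idomainType) (s c : nat) (F : 'I_s -> R).
Hypothesis c_gt0 : (0 < c)%N.
Hypothesis lt_cs : (c < s)%N.
Hypothesis quasi_reg : forall A : {set 'I_s}, #|A| = c -> quasi_regular F A.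
Hypothesis regular_off : forall (A : {set 'I_s}) i, #|A| = c -> i \notin A ->
  nonzerodiv F A i.
Variables (k : fieldType) (eps : {rmorphism R -> k}).
Hypothesis eps0 : forall i, eps (F i) = 0.
Implicit Types (A B : {set 'I_s}) (a b e g : 'X_{1..s}).

Local Notation sym_exp := (@sym_exp s c).
Local Notation minimal := (@minimal s c).
Local Notation pow_exp := (@pow_exp s c).
Local Notation I := (star_ideal c F).

Lemma star_ideal_span : I = span F (sym_exp 1).
Proof.
apply/seteqP; split => f.
  move=> If; apply/(intersection_span c_gt0 quasi_reg regular_off) => A cA.
  by rewrite -ideal_gen_pw; apply: If.
move=> /(intersection_span c_gt0 quasi_reg regular_off) fA A /= cA.
by rewrite ideal_gen_pw; apply: fA.
Qed.

Lemma ideal_pow_span m : ideal_pow I m = span F (pow_exp m).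
Proof.
apply/seteqP; split.
  apply: (ideal_gen_min (span_ideal _ _)) => _ [x [Ix ->]].
  elim: m x Ix => [|m IH] x Ix.
    by rewrite big_ord0 -(fmon0 F); apply: span_mon.
  rewrite big_ord_recl; apply: (span_mul (E1 := sym_exp 1) (E2 := pow_exp m)).
  - by move=> a b Sa Pb; exists a, b.
  - by rewrite -star_ideal_span; apply: Ix.
  - by apply: IH => i; apply: Ix.
apply: (span_min (ideal_gen_ideal _)).
elim: m => [|m IH] b0 /=.
  move=> ->; rewrite fmon0; apply: sub_ideal_gen.
  by exists (fun _ => 0); split; [case|rewrite big_ord0].
move=> [a [b [Sa Pb ->]]]; rewrite fmonD; apply: ideal_pow_mul; last exact: IH.
by rewrite star_ideal_span; apply: span_mon.
Qed.

Lemma eps_fmon a : eps (fmon F a) = (a == 0%MM)%:R.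
Proof.
rewrite /fmon rmorph_prod; have [->|a0] := eqVneq a 0%MM.
  by rewrite big1 // => i _; rewrite mnm0E expr0 rmorph1.
have [/existsP[i ai]|/existsPn h] := boolP [exists i, (0 < a i)%N]; last first.
  case/eqP: a0; apply/mnmP => i; rewrite mnm0E; apply/eqP.
  by rewrite -leqn0 leqNgt h.
by rewrite (bigD1 i) //= rmorphXn /= eps0 expr0n eqn0Ngt ai mul0r.
Qed.

Lemma eps_pw1 A f : pw F A 1 f -> eps f = 0.
Proof.
move=> [t [ht ->]]; rewrite /fsum rmorph_sum big1_seq //= => x /ht /= wx.
rewrite rmorphM eps_fmon; case: eqP => [x0|_]; last by rewrite mulr0.
by rewrite x0 wt0 in wx.
Qed.

(** Let B carry the c smallest entries of a, so that wt B a = m and all terms of t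
    have B-degree at least m.  Those with the B-part of a are multiples of F^a by
    [minimal_agree].  Quasi-regularity and cancellation of the F_i with i outside B
    put the sum Y of their cofactors in (F_B), and eps kills every cofactor that
    is a nontrivial monomial. *)
Lemma minimal_coef m a t : (0 < m)%N -> minimal m a ->
  (forall x, x \in t -> sym_exp m x.2) -> fsum F t = 0 -> eps (coef t a) = 0.
Proof.
move=> m0 mina ht t0; have [B lB] := lightest_exists lt_cs a; have cB := proj1 lB.
pose hi := [seq x : R * 'X_{1..s} <- t | (m < wt B x.2)%N].
pose lo := [seq x : R * 'X_{1..s} <- t | ~~ (m < wt B x.2)%N].
have lo_in x : x \in lo -> sym_exp m x.2 /\ wt B x.2 = m.
  rewrite mem_filter -leqNgt => /andP[xm /ht Sx]; split=> //.
  by apply/eqP; rewrite eqn_leq xm Sx.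
pose forms :=
  [seq (x.1 * fmon F (x.2 - res B x.2)%MM, res B x.2) | x : R * 'X_{1..s} <- lo].
have lo_pw : pw F B m.+1 (fsum F forms).
  have -> : fsum F forms = fsum F lo.
    rewrite /fsum big_map; apply: eq_bigr => x _ /=.
    by rewrite -mulrA -fmonD submK // res_le.
  have -> : fsum F lo = - fsum F hi.
    apply/eqP; rewrite -addr_eq0 addrC -[X in _ == X]t0; apply/eqP.
    by rewrite [in RHS]/fsum (bigID (fun x => (m < wt B x.2)%N)) /= /fsum !big_filter.
  rewrite -mulN1r; apply: pwM; exists hi; split=> // x.
  by rewrite mem_filter => /andP[].
pose Y := \sum_(x <- lo | res B x.2 == res B a) x.1 * fmon F (x.2 - a)%MM.
have lo_ge x : x \in lo -> res B x.2 = res B a -> (a <= x.2)%MM.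
  move=> /lo_in[Sx _] /mnmP ex.
  apply: (minimal_agree c_gt0 lt_cs m0 mina lB Sx) => i iB.
  by have := ex i; rewrite !resE iB.
have eY : coef forms (res B a) = Y * fmon F (a - res B a)%MM.
  rewrite /coef big_map mulr_suml big_seq_cond [RHS]big_seq_cond.
  apply: eq_bigr => x /= /andP[xlo /eqP ex].
  rewrite -mulrA -fmonD ex; congr (_ * fmon F _).
  apply/mnmP => i; rewrite !(mnmDE, mnmBE) addnBA ?subnK //.
    exact: (mnm_lepP (lo_ge _ xlo ex)).
  exact: (mnm_lepP (res_le B a)).
have : eps Y = 0.
  apply: (@eps_pw1 B); apply: (nonzerodiv_fmon regular_off (a := (a - res B a)%MM)) => //.
    by move=> i iB; rewrite mnmBE resE iB subnn.
  rewrite -eY; apply: (quasi_reg cB (j := m)) => //.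
  move=> _ /mapP[x /lo_in[_ wx] ->] /=; rewrite -wx; exact: formexp_res.
move=> <-; rewrite /Y /coef !rmorph_sum /= big_filter_cond big_seq_cond [RHS]big_seq_cond.
rewrite [RHS]big_mkcond [LHS]big_mkcond; apply: eq_bigr => x _.
have [xt|] := boolP (x \in t) => //=.
have [->|xa] := eqVneq x.2 a.
  have -> : ~~ (m < wt B a)%N by rewrite (minimal_wt c_gt0 lt_cs m0 mina lB) ltnn.
  have -> : (a - a = 0)%MM by apply/mnmP => i; rewrite mnmBE subnn mnm0E.
  by rewrite eqxx fmon0 mulr1.
case: ifP => // /andP[xm /eqP ex].
rewrite rmorphM eps_fmon; case: eqP => [x0|_]; last by rewrite mulr0.
have xlo : x \in lo by rewrite mem_filter xm.
by case/eqP: xa; rewrite -(submK (lo_ge _ xlo ex)) x0 add0m.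
Qed.

End StarGenerators.

(** * Dickson's lemma, noetherianity and associated primes *)

Section Dickson.

(** Choose repeatedly an index where u takes its least value over the remaining
    tail. *)
Lemma nondecreasing_subseq (u : nat -> nat) : exists phi : nat -> nat,
  {homo phi : i j / i < j} /\ {homo u \o phi : i j / i <= j}.
Proof.
have /choice[h hh] N : exists i, N <= i /\ forall j, i <= j -> u i <= u j.
  have ex : exists v, `[< exists2 j, N <= j & u j = v >].
    by exists (u N); apply/asboolP; exists N.
  case: (ex_minnP ex) => v /asboolP[i Ni ui] minv.
  exists i; split=> // j ij; rewrite ui; apply: minv; apply/asboolP.
  by exists j => //; apply: leq_trans ij.
pose phi := fix phi i := if i is j.+1 then h (phi j).+1 else h 0.
have phiS i : phi i < phi i.+1 by case: (hh (phi i).+1).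
have incr : {homo phi : i j / i < j} by apply: homo_ltn => //; exact: ltn_trans.
exists phi; split=> // i j ij.
have [_ min_i] : 0 <= phi i /\ forall j, phi i <= j -> u (phi i) <= u j.
  by case: (i) => [|p]; split=> //; case: (hh (phi p).+1) || case: (hh 0).
by apply: min_i; apply: (ltnW_homo incr).
Qed.

(** Dickson's lemma: pass to a subsequence that is nondecreasing in one coordinate
    after another. *)
Lemma dickson n (u : nat -> 'X_{1..n}) : exists i j, i < j /\ (u i <= u j)%MM.
Proof.
suff gen d : exists phi : nat -> nat, {homo phi : i j / i < j} /\
    forall x : 'I_n, x < d -> {homo (fun i => u (phi i) x) : i j / i <= j}.
  have [phi [incr mon]] := gen n.
  exists (phi 0), (phi 1); split; first exact: incr.
  by apply/mnm_lepP => x; exact: (mon x (ltn_ord x) 0 1).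
elim: d => [|d [phi [incr mon]]]; first by exists id; split=> // x; rewrite ltn0.
have [dn|nd] := ltnP d n; last first.
  exists phi; split=> // x; rewrite ltnS leq_eqVlt => /orP[/eqP xd|]; last exact: mon.
  by have := ltn_ord x; rewrite xd ltnNge nd.
have [psi [incr' mon']] := nondecreasing_subseq (fun i => u (phi i) (Ordinal dn)).
exists (phi \o psi); split=> [i j /incr'/incr //|x].
rewrite ltnS leq_eqVlt => /orP[/eqP xd|xd] i j ij /=; last first.
  by apply: mon => //; apply: (ltnW_homo incr').
by have -> : x = Ordinal dn; [apply: val_inj|apply: mon'].
Qed.

End Dickson.

Section Noetherian.
Local Open Scope classical_set_scope.
Local Open Scope ring_scope.

Definition noetherian (R : comNzRingType) := forall K : nat -> set R,
  (forall i, is_ideal (K i)) -> (forall i, K i `<=` K i.+1) ->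
  exists i, K i.+1 `<=` K i.

(** Hilbert's basis theorem over a field: from a strictly ascending chain pick
    elements of least leading monomial in the successive differences; by
    Dickson's lemma one leading monomial divides a later one, and cancelling it
    contradicts minimality. *)
Lemma mpoly_noetherian (k : fieldType) n : noetherian {mpoly k[n]}.
Proof.
move=> K idK incK; apply: contrapT => hK.
have {hK}new i : exists f, K i.+1 f /\ ~ K i f.
  apply: contrapT => h; apply: hK; exists i => f Kf.
  by apply: contrapT => nK; apply: h; exists f.
have /choice[f hf] i : exists f, [/\ K i.+1 f, ~ K i f &
    forall g, K i.+1 g -> ~ K i g -> ~~ (mlead g < mlead f)%O].
  have [f [Kf nK]] := new i; elim/mleadrect: f Kf nK => f IH Kf nK.
  have [[g [Kg nKg lt]]|h] :=
      pselect (exists g, [/\ K i.+1 g, ~ K i g & (mlead g < mlead f)%O]).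
    exact: (IH g lt Kg nKg).
  by exists f; split=> // g Kg nKg; apply/negP => lt; apply: h; exists g.
have [i [j [ij le]]] := dickson (fun i => mlead (f i)).
have [Ki nKi _] := hf i; have [Kj nKj minj] := hf j.
have incr p q : (p <= q)%N -> K p `<=` K q.
  move=> pq; rewrite -(subnKC pq); elim: (q - p)%N => [|r IH]; first by rewrite addn0.
  by rewrite addnS => x /IH; apply: incK.
have Kij : K j (f i) by apply: incr Ki.
have fi0 : f i != 0 by apply/eqP => e; apply: nKi; rewrite e; case: (idK i).
pose d := (mlead (f j) - mlead (f i))%MM.
have ed : mlead (f j) = (d + mlead (f i))%MM by rewrite /d submK.
pose q := (mleadc (f j) / mleadc (f i)) *: (f i * 'X_[d]).
have Kq : K j q.
  by case: (idK j) => _ _ KM; rewrite /q -mul_mpolyC [f i * _]mulrC; apply/KM/KM.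
pose g := f j - q.
have Kg : K j.+1 g by apply: is_idealB => //; apply: incK.
have nKg : ~ K j g.
  move=> h; apply: nKj; rewrite -(subrK q (f j)).
  by case: (idK j) => _ + _; apply.
have g0 : g != 0 by apply/eqP => e; apply: nKg; rewrite e; case: (idK j).
have := minj g Kg nKg; rewrite lt_neqAle negb_and negbK => /orP[/eqP e|].
  have /eqP[] : mleadc g != 0 by rewrite mleadc_eq0.
  rewrite e /g mcoeffB mcoeffZ {3}ed mcoeffMX divfK ?subrr //.
  by rewrite mleadc_eq0.
case/negP; apply: le_trans (mleadB_le _ _) _; rewrite leUx lexx /=.
apply: le_trans (mleadZ_le _ _) _; apply: le_trans (mleadM_le _ _) _.
by rewrite mleadXm ed addmC.
Qed.

(** A maximal element among the proper colon ideals (J : g y) is prime: if u v lies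
    in it and u does not, then (J : u g y) is proper, hence no larger, and
    contains v. *)
Lemma associated_prime (R : comNzRingType) (J : set R) y :
  noetherian R -> is_ideal J -> ~ J y ->
  exists g, is_prime_ideal [set f | J (f * (g * y))].
Proof.
move=> noeth idJ nJy; pose colon g := [set f | J (f * (g * y))].
have [J0 JD JM] := idJ.
have id_colon g : is_ideal (colon g).
  rewrite /colon; split=> [|a b|r a] /=; first by rewrite mul0r.
    by rewrite mulrDl; apply: JD.
  by rewrite -mulrA; apply: JM.
have [g [nJg maxg]] : exists g, ~ J (g * y) /\
    forall h, ~ J (h * (g * y)) -> colon (h * g) `<=` colon g.
  apply: contrapT => hmax.
  have /choice[nxt hn] (g : {g : R | ~ J (g * y)}) :
      exists g' : {g : R | ~ J (g * y)},
        colon (sval g) `<=` colon (sval g') /\ ~ (colon (sval g') `<=` colon (sval g)).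
    case: g => g ng; apply: contrapT => h0; apply: hmax; exists g; split=> // h nh.
    have nhg : ~ J (h * g * y) by rewrite -mulrA.
    apply: contrapT => ns; apply: h0; exists (exist _ (h * g) nhg); split=> //=.
    move=> f; rewrite /colon /= => Jf.
    by rewrite -(mulrA h) mulrCA; apply: JM.
  have n1 : ~ J (1 * y) by rewrite mul1r.
  pose K i := colon (sval (iter i nxt (exist _ 1 n1))).
  have [i Ki] := noeth K (fun i => id_colon _) (fun i => proj1 (hn _)).
  exact: (proj2 (hn _)) Ki.
exists g; split.
  split.
  - by rewrite in_setE /= mul0r.
  - by apply/negP; rewrite in_setE /= mul1r.
  - move=> a u v; rewrite !in_setE /= => hu hv.
    by rewrite mulrDl -mulrA; apply: JD => //; apply: JM.
move=> u v; rewrite in_setE /= => huv; rewrite -[_ || _]negbK negb_or.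
apply/negP => /andP[/negP nu /negP nv]; apply: nv; rewrite in_setE /=.
apply: (maxg u); first by move=> h; apply: nu; rewrite in_setE.
rewrite /colon /=; suff -> : v * (u * g * y) = u * v * (g * y) by [].
by rewrite -mulrA mulrCA mulrA.
Qed.

End Noetherian.

(** * The symbolic powers as intersections *)

Section SymbolicPowers.
Local Open Scope classical_set_scope.
Local Open Scope ring_scope.
Variable R : idomainType.
Implicit Types (I J P : set R).

Lemma prime_ideal_prod P (T : finType) (f : T -> R) (D : pred T) :
  is_prime_ideal P -> (forall i, D i -> ~ P (f i)) -> ~ P (\prod_(i | D i) f i).
Proof.
move=> [[_ /negP n1 _] prP] nPf; elim/big_ind: _ => [|x y nx ny Pxy|//].
  by move=> P1; apply: n1; rewrite in_setE.
have : x * y \in mem P by rewrite in_setE.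
by case/prP/orP; rewrite in_setE.
Qed.

Lemma prime_ideal0 P : is_prime_ideal P -> P 0.
Proof. by move=> [[+ _ _] _]; rewrite in_setE. Qed.

(** Clear the denominators by their product, which lies outside the prime P. *)
Lemma contractionP P J f : is_prime_ideal P -> is_ideal J ->
  contraction P J f <-> exists2 b, ~ P b & J (b * f).
Proof.
move=> prP idJ; have [J0 JD JM] := idJ; split=> [[r [z [g [locz Jg ef]]]]|[b nPb Jbf]].
  have /choice[ab hab] i : exists ab : R * R,
      ~ P ab.2 /\ z i = tofrac ab.1 / tofrac ab.2.
    by have [a [b [nPb ->]]] := locz i; exists (a, b).
  have nz i : tofrac (ab i).2 != 0.
    rewrite tofrac_eq0; apply/eqP => e; apply: (proj1 (hab i)).
    by rewrite e; apply: prime_ideal0.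
  exists (\prod_i (ab i).2).
    by apply: prime_ideal_prod => // i _; case: (hab i).
  suff -> : (\prod_i (ab i).2) * f
      = \sum_i ((ab i).1 * \prod_(j | j != i) (ab j).2) * g i.
    by apply: (is_ideal_sum idJ) => i _ _; apply: JM.
  apply/eqP; rewrite -tofrac_eq; apply/eqP; rewrite tofracM ef mulr_sumr rmorph_sum /=.
  apply: eq_bigr => i _; rewrite (proj2 (hab i)) (bigD1 i) //= !tofracM.
  rewrite !mulrA; congr (_ * _).
  by rewrite -(mulrA (tofrac (ab i).2)) mulrC mulKf // mulrC.
exists 1%N, (fun _ => (tofrac b)^-1), (fun _ => b * f); split=> // [_|].
  by exists 1, b; rewrite tofrac1 mul1r.
rewrite big_ord1 tofracM mulrA mulVf ?mul1r // tofrac_eq0.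
by apply/eqP => e; apply: nPb; rewrite e; apply: prime_ideal0.
Qed.

Section Star.
Variables (s c : nat) (F : 'I_s -> R).
Hypothesis c_gt0 : (0 < c)%N.
Hypothesis lt_cs : (c < s)%N.
Hypothesis noeth : noetherian R.
Hypothesis quasi_reg : forall A : {set 'I_s}, #|A| = c -> quasi_regular F A.
Hypothesis regular_off : forall (A : {set 'I_s}) i, #|A| = c -> i \notin A ->
  nonzerodiv F A i.
Implicit Types (A B : {set 'I_s}).

Local Notation I := (star_ideal c F).

Lemma star_idealP f : I f <-> forall A, #|A| = c -> pw F A 1 f.
Proof.
by split=> h A cA; [rewrite -ideal_gen_pw|rewrite /= ideal_gen_pw]; apply: h.
Qed.

Definition off A : R := \prod_(j | j \notin A) F j.

Lemma off_pw A B : #|A| = c -> #|B| = c -> B != A -> pw F B 1 (off A).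
Proof.
move=> cA cB BA; have [j jB jA] : exists2 j, j \in B & j \notin A.
  by apply/subsetPn; apply: contra BA => sBA; rewrite eqEcard sBA cA cB leqnn.
by rewrite /off (bigD1 j) //=; apply: pw_set => //; apply: pw0.
Qed.

Lemma off_nonzerodiv A r : #|A| = c -> pw F A 1 (off A * r) -> pw F A 1 r.
Proof.
move=> cA; rewrite /off; elim/big_rec: _ => [|i x iA IH]; first by rewrite mul1r.
by rewrite -mulrA mulrC => /(regular_off cA iA)/IH.
Qed.

Lemma off_star A f : #|A| = c -> pw F A 1 f -> I (off A * f).
Proof.
move=> cA fA; apply/star_idealP => B cB; have [->|BA] := eqVneq B A.
  exact: pwM.
by rewrite mulrC; apply: pwM; apply: off_pw.
Qed.

(** Each F_i with i in A becomes an element of I after multiplication by [off A],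
    so m factors [off A] turn m variables of A into elements of I. *)
Lemma off_pow_mon A m a :
  #|A| = c -> (m <= wt A a)%N -> ideal_pow I m (off A ^+ m * fmon F a).
Proof.
move=> cA; elim: m a => [|m IH] a wa.
  rewrite expr0 mul1r -[fmon F a]mulr1.
  case: (ideal_pow_ideal I 0) => _ _; apply.
  by apply: sub_ideal_gen; exists (fun _ => 0); split; [case|rewrite big_ord0].
have : (0 < wt A a)%N by apply: leq_trans wa.
move=> /wt_gt0[i iA ai].
have le1 : (U_(i) <= a)%MM by apply: mnm1_le.
rewrite -(submK le1) addmC fmonD fmonU exprS mulrACA; apply: ideal_pow_mul.
  apply: off_star => //; rewrite -[F i]mulr1; apply: pw_set => //; exact: pw0.
by apply: IH; move: wa; rewrite -{1}(submK le1) wtD wtU iA addn1.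
Qed.

Lemma off_pow A m f : #|A| = c -> pw F A m f -> ideal_pow I m (off A ^+ m * f).
Proof.
move=> cA [t [ht ->]]; rewrite /fsum mulr_sumr.
have idpow := ideal_pow_ideal I m.
apply: (is_ideal_sum idpow) => x /ht /= wx _; rewrite mulrCA.
by case: idpow => _ _; apply; apply: off_pow_mon.
Qed.

(** The associated primes of R/(F_A) are associated primes of R/I: multiplying
    by the product of the other F_j turns an annihilator modulo (F_A) into one
    modulo I. *)
Lemma ass_star A y : #|A| = c -> is_prime_ideal [set f | pw F A 1 (f * y)] ->
  Ass I [set f | pw F A 1 (f * y)].
Proof.
move=> cA prP; split=> //; exists (off A * y); apply/seteqP; split=> f /=.
  by rewrite mulrCA; apply: off_star.
by rewrite mulrCA => /star_idealP /(_ A cA) /off_nonzerodiv; apply.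
Qed.

(** If P = (I : x), then x is outside some (F_A), and [off A] in P would put
    [off A] * x in (F_A).  At such a prime I^m and (F_A)^m agree by [off_pow]. *)
Lemma ass_off P : Ass I P -> exists2 A : {set 'I_s}, #|A| = c & ~ P (off A).
Proof.
move=> [prP [x eP]]; have nIx : ~ I x.
  move=> Ix; case: prP => [[_ /negP n1 _] _]; apply: n1.
  by rewrite in_setE eP /= mul1r.
have [A [cA nAx]] : exists A, #|A| = c /\ ~ pw F A 1 x.
  apply: contrapT => h; apply: nIx; apply/star_idealP => A cA.
  by apply: contrapT => nA; apply: h; exists A.
exists A => //; rewrite eP /= => /star_idealP /(_ A cA) /off_nonzerodiv h.
exact/nAx/h.
Qed.

(** Both sides are the intersection of the ideals (F_A)^m.  Suppose that f is in
    the symbolic power and in (F_A)^i but not in (F_A)^(i+1), with i < m.  Some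
    coefficient y of its leading form is not in (F_A); an associated prime
    P = ((F_A) : h y) of R/(F_A) is associated to R/I, so b f is in I^m for some b
    outside P, and quasi-regularity gives b h y in (F_A), that is, b in P. *)
Theorem symbolic_pow_star m : symbolic_pow I m = span F (@sym_exp s c m).
Proof.
have idpow := ideal_pow_ideal I m.
have Ispan := intersection_span c_gt0 quasi_reg regular_off.
apply/seteqP; split=> f; last first.
  move=> /Ispan fA P AssP; have [A cA nPA] := ass_off AssP; have [prP _] := AssP.
  apply/(contractionP _ prP idpow); exists (off A ^+ m); last exact: off_pow cA (fA A cA).
  by rewrite -[m](card_ord m) -prodr_const; apply: prime_ideal_prod.
move=> symf; apply/Ispan => A cA.
suff gen i : (i <= m)%N -> pw F A i f by apply: gen.
elim: i => [_|i IH im]; first exact: pw0.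
have [t [ht ef]] := pw_homog (IH (ltnW im)).
rewrite ef; apply: pw_coef => [x /ht /andP[/eqP-> _] //|g].
apply: contrapT => ny; have [h prP] := associated_prime noeth (pw_ideal F A 1) ny.
have [b nPb] := proj1 (contractionP _ prP idpow) (symf _ (ass_star cA prP)).
rewrite (ideal_pow_span c_gt0 quasi_reg regular_off) => bf.
apply: nPb => /=; rewrite mulrA -coef_scale; apply: (quasi_reg cA (j := i)).
  exact: (scale_exp (P := fun a => formexp A i a)).
rewrite fsum_scale -ef mulrAC mulrC; apply: pwM; apply: pw_leq im _ _.
by apply: sub_span bf => a /pow_sym_exp /(_ A cA).
Qed.

End Star.
End SymbolicPowers.

(** * Minimal generators of the symbolic powers and symbolic defect *)

Section StarCounts.
Local Open Scope classical_set_scope.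
Local Open Scope ring_scope.
Variables (R : idomainType) (s c : nat) (F : 'I_s -> R).
Hypothesis c_gt0 : (0 < c)%N.
Hypothesis lt_cs : (c < s)%N.
Hypothesis noeth : noetherian R.
Hypothesis quasi_reg : forall A : {set 'I_s}, #|A| = c -> quasi_regular F A.
Hypothesis regular_off : forall (A : {set 'I_s}) i, #|A| = c -> i \notin A ->
  nonzerodiv F A i.
Variables (k : fieldType) (eps : {rmorphism R -> k}).
Hypothesis eps0 : forall i, eps (F i) = 0.

Local Notation sym_exp := (@sym_exp s c).
Local Notation minimal := (@minimal s c).
Local Notation I := (star_ideal c F).

(** A monomial of the symbolic power is a multiple of a minimal one, which is
    either listed in l or already in the span of E; the relations among the listed
    ones are controlled by [minimal_coef]. *)
Lemma mu_span m (E : set 'X_{1..s}) (l : seq 'X_{1..s}) :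
  (0 < m)%N -> E `<=` sym_exp m -> uniq l ->
  (forall a, a \in l <-> minimal m a /\ ~ E a) ->
  mu_quot_is (span F (sym_exp m)) (span F E) (size l).
Proof.
move=> m0 ES ul hl; pose e (i : 'I_(size l)) := nth 0%MM l i.
have el i : e i \in l by apply: mem_nth.
have idE := span_ideal F E; have [E0 ED EM] := idE.
apply: (@mu_quot_is_basis R k eps _ _ _ (fun i => fmon F (e i))) => //.
- by move=> i; apply: span_mon; case/hl: (el i) => -[].
- pose K : set R := [set f | exists r : 'I_(size l) -> R,
    span F E (f - \sum_i r i * fmon F (e i))].
  have idK : is_ideal K.
    split=> [|f h [r hr] [r' hr']|x f [r hr]].
    + by exists (fun _ => 0); rewrite big1 ?subr0 // => i _; rewrite mul0r.
    + exists (fun i => r i + r' i).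
      under eq_bigr do rewrite mulrDl.
      by rewrite big_split /= opprD addrACA; apply: ED.
    + exists (fun i => x * r i); under eq_bigr do rewrite -mulrA.
      by rewrite -mulr_sumr -mulrBr; apply: EM.
  apply: (span_min idK) => a Sa; have [b mb ba] := minimal_below Sa.
  case: (idK) => _ _ KM; rewrite -(submK ba) fmonD; apply: (KM).
  have [Eb|nEb] := pselect (E b).
    exists (fun _ => 0); rewrite big1 ?subr0 => [|i _]; last by rewrite mul0r.
    exact: span_mon.
  have bl : b \in l by apply/hl.
  have ibl : (index b l < size l)%N by rewrite index_mem.
  exists (fun i => (i == Ordinal ibl)%:R).
  rewrite (bigD1 (Ordinal ibl)) //= eqxx mul1r /e /= nth_index // big1 => [|i].
    by rewrite addr0 subrr.
  by move=> /negPf->; rewrite mul0r.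
move=> r [u [hu eu]] i.
pose t := [seq (r j, e j) | j <- enum 'I_(size l)] ++ scale (-1) u.
have -> : r i = coef t (e i).
  rewrite coef_cat coef_scale [X in -1 * X]/coef [X in -1 * X]big1_seq; last first.
    by move=> x /andP[/eqP xe /hu Ex]; case/hl: (el i) => _ []; rewrite -xe.
  rewrite mulr0 addr0 /coef big_map big_enum_cond /= (bigD1 i) //= big1 ?addr0 //.
  by move=> j /andP[/eqP /(congr1 (index^~ l))]; rewrite !index_uniq // => /val_inj->;
    rewrite eqxx.
have [mi _] := (hl (e i)).1 (el i).
apply: (minimal_coef c_gt0 lt_cs quasi_reg regular_off eps0 m0 mi).
  move=> x; rewrite mem_cat => /orP[/mapP[j _ ->]|/mapP[y /hu Ey ->]] /=; last exact: ES.
  by case/hl: (el j) => -[].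
rewrite fsum_cat fsum_scale -eu mulN1r /fsum big_map big_enum /=.
exact: subrr.
Qed.

(** By [minimal_pow] the minimal exponents that have an entry m are those of the
    ordinary power, so the symbolic defect counts the others. *)
Lemma star_mu m (l1 l2 : seq 'X_{1..s}) : (0 < m)%N ->
  uniq (l1 ++ l2) -> (forall a, a \in l1 ++ l2 <-> minimal m a) ->
  (forall a, a \in l1 -> exists i, (m <= a i)%N) ->
  (forall a, a \in l2 -> forall i, (a i < m)%N) ->
  mu_is (symbolic_pow I m) (size l1 + size l2) /\ sdefect_is I m (size l2).
Proof.
move=> m0 ul hl h1 h2.
have symE := symbolic_pow_star c_gt0 noeth quasi_reg regular_off m.
split.
  have s0 : span F classical_sets.set0 = [set 0].
    apply/seteqP; split=> f; last by move=> ->; case: (span_ideal F classical_sets.set0).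
    move: f; apply: span_min => // ; split=> [//|x y -> ->|r x ->] /=.
      by rewrite addr0.
    by rewrite mulr0.
  rewrite /mu_is symE -s0 -size_cat; apply: mu_span => // a.
  by split=> [/hl ma|[ma _]]; [split=> // -[]|apply/hl].
rewrite /sdefect_is symE (ideal_pow_span c_gt0 quasi_reg regular_off).
have ul2 : uniq l2 by move: ul; rewrite cat_uniq => /and3P[].
apply: mu_span => //; first exact: pow_sym_exp.
move=> a; split=> [al2|[ma nPa]].
  have ma : minimal m a by apply/hl; rewrite mem_cat al2 orbT.
  split=> // /(minimal_pow c_gt0 lt_cs m0 ma)[i].
  by rewrite leqNgt h2.
move: ((hl a).2 ma); rewrite mem_cat => /orP[/h1 ai|//].
by case: nPa; apply/(minimal_pow c_gt0 lt_cs m0 ma).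
Qed.

End StarCounts.

(** * Enumeration of the minimal exponents *)

Section Shapes.
Variables (s c : nat).
Hypothesis c_gt0 : 0 < c.
Hypothesis lt_cs : c < s.
Implicit Types (A B Z T : {set 'I_s}) (a b : 'X_{1..s}).

Local Notation sym_exp := (@sym_exp s c).
Local Notation minimal := (@minimal s c).
Local Notation lightest := (@lightest s c).

(** An exponent is the increasing chain of its levels; [depth] measures by how much
    a level falls short of c elements. *)
Definition level a u : {set 'I_s} := [set i | a i <= u].
Definition depth a u := c - #|level a u|.

Lemma sum_ltn_ord m n : \sum_(u < m) (u < n) = minn n m.
Proof.
elim: m => [|m IH]; first by rewrite big_ord0 minn0.
by rewrite big_ord_recr IH /=; case: ltnP; lia.
Qed.

Lemma sum_off_level m a B :
  \sum_(u < m) #|B :\: level a u| = \sum_(i in B) minn (a i) m.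
Proof.
transitivity (\sum_(u < m) \sum_(i in B) (u < a i)).
  apply: eq_bigr => u _; rewrite -sum1_card [LHS]big_mkcond [RHS]big_mkcond /=.
  by apply: eq_bigr => i _; rewrite !inE -ltnNge; case: (i \in B); case: ltnP.
rewrite exchange_big; apply: eq_bigr => i _; exact: sum_ltn_ord.
Qed.

Lemma depth_le a B u : #|B| = c -> depth a u <= #|B :\: level a u|.
Proof.
move=> cB; rewrite /depth -cB -(cardsID (level a u) B) leq_subLR leq_add2r.
exact/subset_leq_card/finset.subsetIr.
Qed.

(** Either some entry on B exceeds u, and then level a u lies inside B, or both
    numbers are 0. *)
Lemma lightest_depth a B u : lightest a B -> depth a u = #|B :\: level a u|.
Proof.
move=> lB; have cB := proj1 lB; apply/eqP; rewrite eqn_leq depth_le //=.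
have [->|/set0Pn[i]] := eqVneq (B :\: level a u) finset.set0; first by rewrite cards0.
rewrite !inE -ltnNge => /andP[ui iB].
have sub : level a u \subset B.
  apply/fintype.subsetP => l; rewrite inE => lu; apply: contraLR lu => lnB.
  by rewrite -ltnNge (leq_trans ui) // (lightest_le lB).
by rewrite cardsD (finset.setIidPr sub) cB.
Qed.

(** On a lightest set B the entries, cut off at m, have sum the sum of the depths,
    each entry being counted layer by layer. *)
Lemma sym_exp_depth m a : sym_exp m a <-> m <= \sum_(u < m) depth a u.
Proof.
split=> [Sa|h A cA].
  have [B lB] := lightest_exists lt_cs a.
  rewrite (eq_bigr (fun u : 'I_m => #|B :\: level a u|)); last first.
    by move=> u _; apply: lightest_depth.
  rewrite sum_off_level; have [/existsP[i /andP[iB mi]]|/existsPn h] :=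
      boolP [exists i, (i \in B) && (m <= a i)].
    by rewrite (bigD1 i) //= (minn_idPr mi) leq_addr.
  apply: leq_trans (Sa B (proj1 lB)) _; apply: leq_sum => i iB.
  by have := h i; rewrite iB /= -ltnNge leq_min leqnn => /ltnW.
apply: leq_trans h _; apply: (@leq_trans (\sum_(u < m) #|A :\: level a u|)).
  by apply: leq_sum => u _; apply: depth_le.
by rewrite sum_off_level; apply: leq_sum => i _; apply: geq_minl.
Qed.

Lemma level_le a b u : (b <= a)%MM -> level a u \subset level b u.
Proof.
move=> /mnm_lepP ba; apply/fintype.subsetP => i; rewrite !inE; exact: leq_trans.
Qed.

Lemma level_eqT a u i : level a u = [set: 'I_s]%SET -> a i <= u.
Proof. by move/setP/(_ i); rewrite !inE. Qed.

(** Minimality means that no level can grow: a level with fewer than c elements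
    contributes to the sum m of the depths, and any other level is already
    full. *)
Lemma minimal_levels m a : 0 < m -> minimal m a <->
  [/\ forall i, a i <= m, \sum_(u < m) depth a u = m &
      forall u, #|level a u| < c \/ level a u = [set: 'I_s]%SET].
Proof.
move=> m0; split=> [ma|[am da la]].
  have [B lB] := lightest_exists lt_cs a; have cB := proj1 lB.
  split=> [i||u]; first exact: (minimal_bound c_gt0 lt_cs).
    rewrite (eq_bigr (fun u : 'I_m => #|B :\: level a u|)); last first.
      by move=> u _; apply: lightest_depth.
    rewrite sum_off_level -[RHS](minimal_wt c_gt0 lt_cs m0 ma lB).
    by apply: eq_bigr => i _; apply/minn_idPl/(minimal_bound c_gt0 lt_cs i m0 ma).
  have [i iB ai] := top_attained c_gt0 cB a.
  have [utop|topu] := ltnP u (top B a).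
    left; rewrite -cB; apply: proper_card; apply/properP; split.
      apply/fintype.subsetP => l; rewrite inE => lu; apply: contraLR lu => lnB.
      by rewrite -ltnNge (minimal_out c_gt0 lt_cs m0 ma lB lnB).
    by exists i => //; rewrite inE -ltnNge ai.
  right; apply/setP => l; rewrite !inE; apply: leq_trans topu.
  have [lB'|lnB] := boolP (l \in B); first exact: top_le.
  by rewrite (minimal_out c_gt0 lt_cs m0 ma lB lnB).
split=> [|b Sb ba]; first by apply/sym_exp_depth; rewrite da.
have le u : depth b u <= depth a u.
  by apply: leq_sub2l; apply/subset_leq_card/level_le.
have eqd (u : 'I_m) : depth b u = depth a u.
  have : \sum_(u < m) depth b u == \sum_(u < m) depth a u.
    by rewrite eqn_leq leq_sum //= da; apply/sym_exp_depth.
  move=> /eqP; have [] := @leqif_sum _ predT (fun u : 'I_m => depth b u == depth a u)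
    (fun u : 'I_m => depth b u) (fun u : 'I_m => depth a u).
    by move=> v _; split; [exact: le|].
  by move=> _ h /eqP; rewrite h => /forallP/(_ u)/eqP.
have eql u : u < m -> level b u = level a u.
  move=> um; have sub := level_le u ba; have [lt|full] := la u; last first.
    by apply/eqP; rewrite finset.eqEsubset full finset.subsetT -full.
  apply/eqP; rewrite eq_sym eqEcard sub andTb.
  by have : depth b u = depth a u := eqd (Ordinal um); rewrite /depth; lia.
apply/mnmP => i; apply/eqP; rewrite eqn_leq (mnm_lepP ba) /=.
have [bm|mb] := ltnP (b i) m; last by apply: leq_trans mb.
by have /setP/(_ i) := eql _ bm; rewrite !inE leqnn.
Qed.

Definition shaped Z T v : 'X_{1..s} :=
  [multinom if i \in Z then 0 else if i \in T then 1 else v | i < s].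

Definition zone n t : seq ({set 'I_s} * {set 'I_s}) :=
  [seq (Z, T) | Z <- enum [set Z : {set 'I_s} | #|Z| == n],
                T <- enum [set T : {set 'I_s} | (T \subset ~: Z) & #|T| == t]].

Lemma zoneP n t Z T :
  ((Z, T) \in zone n t) = [&& #|Z| == n, [disjoint T & Z] & #|T| == t].
Proof.
apply/allpairsPdep/and3P => [[Z' [T' [+ + [-> ->]]]]|[cZ TZ cT]].
  by rewrite !mem_enum !inE -finset.disjoints_subset => -> /andP[-> ->].
by exists Z, T; rewrite !mem_enum !inE cZ -finset.disjoints_subset TZ cT.
Qed.

Lemma zone_uniq n t : uniq (zone n t).
Proof.
apply: allpairs_uniq_dep => [|Z _|[Z T] [Z' T'] _ _ []]; rewrite ?enum_uniq //.
by move=> -> ->.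
Qed.

Lemma size_zone n t : size (zone n t) = 'C(s, n) * 'C(s - n, t).
Proof.
rewrite size_allpairs_dep sumnE big_map big_enum /=.
rewrite (eq_bigr (fun _ => 'C(s - n, t))) => [|Z].
  by rewrite sum_nat_const card_draws card_ord.
rewrite inE => /eqP cZ; rewrite -cardE cards_draws -cZ.
by rewrite cardsCs finset.setCK card_ord.
Qed.

Lemma shaped_level Z T v u : [disjoint T & Z] -> 0 < v -> (T != finset.set0 -> 1 < v) ->
  level (shaped Z T v) u =
    if u < v then (if u == 0 then Z else Z :|: T) else [set: 'I_s]%SET.
Proof.
move=> dTZ v0 v1; have dis i : i \in T -> i \in Z = false.
  by move=> iT; apply: (disjointFr dTZ).
apply/setP => i; rewrite inE mnmE; case iZ: (i \in Z).
  by case: ltnP => _; rewrite ?inE //; case: ifP => _; rewrite ?inE iZ.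
case iT: (i \in T).
  have {}v1 : 1 < v by apply: v1; apply/set0Pn; exists i.
  by case: u => [|u]; case: (ltnP _ v) => uv; rewrite ?inE ?iZ ?iT //; lia.
by case: ltnP => uv; rewrite ?inE //; case: ifP => _; rewrite ?inE iZ ?iT.
Qed.

(** A shape (p, t, v) stands for the exponents with c - p entries 0, t entries 1
    and all others v.  Their c smallest entries have sum t + (p - t) v. *)
Definition shape : Type := nat * nat * nat.

Definition shape_exps (x : shape) : seq 'X_{1..s} :=
  let: (p, t, v) := x in [seq shaped ZT.1 ZT.2 v | ZT <- zone (c - p) t].

Definition admissible m (x : shape) :=
  let: (p, t, v) := x in
  [&& p <= c, t < p, 0 < v, (0 < t) ==> (1 < v) & t + (p - t) * v == m].

Lemma shape_minimal m x a : admissible m x -> a \in shape_exps x -> minimal m a.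
Proof.
case: x => [[p t] v] /and5P[pc tp v0 /implyP v1 /eqP em] /mapP[[Z T]].
rewrite zoneP => /and3P[/eqP cZ dTZ /eqP cT] ->.
have m0 : 0 < m by rewrite -em; nia.
have vm : v <= m by rewrite -em; nia.
have lev u := shaped_level u dTZ v0; rewrite -card_gt0 cT in lev.
have cZT : #|Z :|: T| = c - p + t.
  have /eqP e0 : #|Z :&: T| == 0 by rewrite cards_eq0 finset.setI_eq0 disjoint_sym.
  by have := cardsUI Z T; rewrite e0 cZ cT addn0.
apply/(minimal_levels _ m0); split=> [i||u].
- rewrite mnmE; case: ifP => // _; case: ifP => // _.
- rewrite (eq_bigr (fun u : 'I_m => (u < v) * (p - t) + (u < 1) * t)); last first.
    move=> [u um] _; rewrite /depth lev //=.
    case: ltnP => uv; last first.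
      by rewrite cardsT card_ord; case: u uv um => [|u] uv um //=; lia.
    by case: u uv um => [|u] uv um /=; rewrite ?cZ ?cZT; lia.
  rewrite big_split -!big_distrl !sum_ltn_ord (minn_idPl vm) (minn_idPl m0) -em.
  by rewrite /= mul1n addnC mulnC.
- rewrite lev //; case: (ltnP u v) => _; last by right.
  by left; case: ifP => _; rewrite ?cZ ?cZT; lia.
Qed.

Lemma depth_anti a u w : u <= w -> depth a w <= depth a u.
Proof.
move=> uw; apply/leq_sub2l/subset_leq_card/fintype.subsetP => i.
by rewrite !inE => /leq_trans; apply.
Qed.

(** When the depth has a constant value q between the first layer and the top v,
    the levels in between have the same size and coincide, so that only 0, 1 and v
    occur as entries. *)
Lemma minimal_shape m a v q : 0 < m -> minimal m a ->
  0 < v -> 0 < q -> (v = 1 -> q = depth a 0) ->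
  (forall u, 0 < u < v -> depth a u = q) -> (v = m \/ depth a v = 0) ->
  a \in shape_exps (depth a 0, depth a 0 - q, v).
Proof.
move=> m0 /(minimal_levels _ m0)[am da la] v0 q0 v1 dq dv.
have cl u : 0 < depth a u -> #|level a u| = c - depth a u by rewrite /depth; lia.
have dn u w : u <= w -> level a u \subset level a w.
  by move=> uw; apply/fintype.subsetP => i; rewrite !inE => /leq_trans; apply.
have d0 : 0 < depth a 0.
  have [->//|v1'] := eqVneq (depth a 0) q.
  have [e|ne] := eqVneq v 1; first by rewrite -v1.
  by rewrite (leq_trans q0) // -(dq 1) ?depth_anti //; lia.
have le_v i : a i <= v.
  case: dv => [->//|dv]; have [lt|full] := la v; first by move: dv; rewrite /depth; lia.
  exact: level_eqT.
pose Z := level a 0; pose T := if v == 1 then finset.set0 else level a 1 :\: Z.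
have lev u : 0 < u < v -> level a u = level a 1.
  move=> uv; apply/esym/eqP; rewrite eqEcard dn ?cl ?dq ?leqnn //; lia.
have ea : a = shaped Z T v.
  apply/mnmP => i; rewrite mnmE; case: ifP; first by rewrite inE leqn0 => /eqP.
  rewrite inE => /negbT; rewrite -ltnNge => ai; rewrite /T; case: eqP => [e|ne].
    by rewrite inE; have := le_v i; lia.
  rewrite !inE -ltnNge ai /=; case: leqP => [a1|a1]; first by lia.
  apply/eqP; rewrite eqn_leq le_v leqNgt; apply/negP => av.
  have /setP/(_ i) : level a (a i) = level a 1 by apply: lev; rewrite ai av.
  by rewrite !inE leqnn leqNgt a1.
apply/mapP; exists (Z, T); last exact: ea.
rewrite zoneP (cl 0) // eqxx /= /T.
case: eqP => [e|ne].
  by rewrite (v1 e) subnn cards0 eqxx andbT finset.disjoints_subset finset.sub0set.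
have -> : [disjoint level a 1 :\: Z & Z].
  rewrite -finset.setI_eq0; apply/eqP/setP => i; rewrite !inE.
  by case: leqP; rewrite ?andbF.
have e1 : depth a 1 = q by apply: dq; lia.
have d1 : depth a 1 <= depth a 0 by apply: depth_anti.
have c0 : depth a 0 <= c by apply: leq_subr.
rewrite cardsD (finset.setIidPr (dn _ _ _)) // (cl 1) ?e1 // (cl 0) //.
by move: d1; rewrite e1; lia.
Qed.

Definition peak a := \max_i a i.

(** The number of zeros and the largest entry tell the shapes apart. *)
Lemma shape_key m x a : admissible m x -> a \in shape_exps x ->
  (#|level a 0|, peak a) = (c - x.1.1, x.2).
Proof.
case: x => [[p t] v] /and5P[pc tp v0 /implyP v1 /eqP em] /mapP[[Z T]].
rewrite zoneP => /and3P[/eqP cZ dTZ /eqP cT] -> /=; congr (_, _).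
  by rewrite shaped_level // ?v0 ?cZ // -card_gt0 cT.
apply/eqP; rewrite eqn_leq; apply/andP; split.
  apply/bigmax_leqP => i _; rewrite mnmE; case: ifP => // _; case: ifP => // _.
have [i iZT] : exists i, i \notin Z :|: T.
  have : ~: (Z :|: T) != finset.set0.
    rewrite -card_gt0 cardsCs finset.setCK card_ord cardsU cZ cT; lia.
  by case/set0Pn => i; rewrite inE; exists i.
move: iZT; rewrite inE negb_or => /andP[/negPf iZ /negPf iT].
by have := leq_bigmax (F := fun i => shaped Z T v i) i; rewrite /= mnmE iZ iT.
Qed.

Lemma shape_exps_uniq m x : admissible m x -> uniq (shape_exps x).
Proof.
case: x => [[p t] v] /and5P[pc tp v0 /implyP v1 /eqP em].
rewrite map_inj_in_uniq ?zone_uniq // => -[Z T] [Z' T'].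
rewrite !zoneP => /and3P[_ d /eqP cT] /and3P[_ d' /eqP cT'] /= e.
have vT : T != finset.set0 -> 1 < v by rewrite -card_gt0 cT.
have vT' : T' != finset.set0 -> 1 < v by rewrite -card_gt0 cT'.
have eZ : Z = Z'.
  by have := shaped_level 0 d v0 vT; rewrite e (shaped_level 0 d' v0 vT') v0 /=.
congr (_, _) => //; rewrite -{Z'}eZ in d' e.
case: (posnP t) => [t0|/v1 v2].
  by move: cT cT'; rewrite t0 => /eqP + /eqP; rewrite !cards_eq0 => /eqP-> /eqP->.
apply/setP => i; have /mnmP/(_ i) := e; rewrite !mnmE.
case iZ: (i \in Z); first by rewrite !(disjointFl _ iZ).
by case: (i \in T); case: (i \in T') => //; lia.
Qed.

Definition shapes_exps (l : seq shape) := flatten [seq shape_exps x | x <- l].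

Lemma shapes_exps_uniq m l : all (admissible m) l ->
  uniq [seq (x.1.1, x.2) | x : shape <- l] -> uniq (shapes_exps l).
Proof.
rewrite /shapes_exps; elim: l => //= x l IH /andP[xm lm] /andP[xl ul].
rewrite cat_uniq (shape_exps_uniq xm) IH // andbT /=; apply/hasPn => a.
move=> /flatten_mapP[y yl ay]; apply: contra xl => /= ax.
have ym := allP lm y yl; apply/mapP; exists y => //.
have := shape_key ym ay; rewrite (shape_key xm ax) => -[pp ->]; congr (_, _).
have adm_le z : admissible m z -> z.1.1 <= c by case: z => [[p t] v] /and5P[].
by move: (adm_le x xm) (adm_le y ym) pp; lia.
Qed.

Lemma size_shape_exps x : x.1.1 <= c -> 
  size (shape_exps x) = 'C(s, c - x.1.1) * 'C(s - c + x.1.1, x.1.2).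
Proof.
case: x => [[p t] v] /= pc; rewrite size_map size_zone; congr (_ * 'C(_, _)); lia.
Qed.

Lemma shape_peak m x a : admissible m x -> a \in shape_exps x -> peak a = x.2.
Proof. by move=> xm /(shape_key xm)[]. Qed.

(** For m at most 4 the depths of a minimal exponent form a partition of m whose
    parts after the first are all equal, and these are the resulting shapes with
    v < m; the partition with all parts 1 is the shape (1, 0, m).  From m = 5 on
    there are other partitions, such as 2 + 2 + 1. *)
Definition lower_shapes m : seq shape :=
  match m with
  | 2 => [:: (2, 0, 1)]
  | 3 => [:: (2, 1, 2); (3, 0, 1)]
  | 4 => [:: (2, 1, 3); (2, 0, 2); (3, 2, 2); (4, 0, 1)]
  | _ => [::]
  end.

Lemma small_minimal_shape m a : 1 < m < 5 -> minimal m a ->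
  exists2 x, x \in (1, 0, m) :: lower_shapes m & x.1.1 <= c /\ a \in shape_exps x.
Proof.
move=> m25 ma; have m0 : 0 < m by case/andP: m25; lia.
have shp v q := @minimal_shape m a v q m0 ma.
have [_ da _] := (minimal_levels a m0).1 ma.
have a1 := @depth_anti a 0 1 isT; have a2 := @depth_anti a 1 2 isT.
have a3 := @depth_anti a 2 3 isT.
have dc : depth a 0 <= c by apply: leq_subr.
have fin v q x : x = (depth a 0, depth a 0 - q, v) ->
    x \in (1, 0, m) :: lower_shapes m ->
    0 < v -> 0 < q -> (v = 1 -> q = depth a 0) ->
    (forall u, 0 < u < v -> depth a u = q) -> (v = m \/ depth a v = 0) ->
    exists2 x, x \in (1, 0, m) :: lower_shapes m & x.1.1 <= c /\ a \in shape_exps x.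
  move=> -> xl v0 q0 v1 dq dv; exists (depth a 0, depth a 0 - q, v) => //.
  by split=> //; apply: shp.
move: m25 da fin; case: m {m0 shp ma} => [|[|[|[|[|m]]]]] // _;
  rewrite !big_ord_recl big_ord0 /= /bump /= ?addn0 ?add1n => da fin.
- have [[e0 e1]|[e0 e1]] : depth a 0 = 1 /\ depth a 1 = 1 \/
      depth a 0 = 2 /\ depth a 1 = 0 by lia.
  + by apply: (fin 2 1 (1, 0, 2)); rewrite ?e0 //; [case=> [|[|u]]|left].
  + by apply: (fin 1 2 (2, 0, 1)); rewrite ?e0 //; [case=> [|[|u]]|right].
- have : depth a 0 = 1 /\ depth a 1 = 1 /\ depth a 2 = 1 \/
    depth a 0 = 2 /\ depth a 1 = 1 /\ depth a 2 = 0 \/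
    depth a 0 = 3 /\ depth a 1 = 0 /\ depth a 2 = 0 by lia.
  case=> [[e0 [e1 e2]]|[[e0 [e1 e2]]|[e0 [e1 e2]]]].
  + by apply: (fin 3 1 (1, 0, 3)); rewrite ?e0 //; [case=> [|[|[|u]]]|left].
  + by apply: (fin 2 1 (2, 1, 2)); rewrite ?e0 //; [case=> [|[|u]]|right].
  + by apply: (fin 1 3 (3, 0, 1)); rewrite ?e0 //; [case=> [|[|u]]|right].
- have : depth a 0 = 1 /\ depth a 1 = 1 /\ depth a 2 = 1 /\ depth a 3 = 1 \/
    depth a 0 = 2 /\ depth a 1 = 1 /\ depth a 2 = 1 /\ depth a 3 = 0 \/
    depth a 0 = 2 /\ depth a 1 = 2 /\ depth a 2 = 0 /\ depth a 3 = 0 \/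
    depth a 0 = 3 /\ depth a 1 = 1 /\ depth a 2 = 0 /\ depth a 3 = 0 \/
    depth a 0 = 4 /\ depth a 1 = 0 /\ depth a 2 = 0 /\ depth a 3 = 0 by lia.
  case=> [[e0 [e1 [e2 e3]]]|[[e0 [e1 [e2 e3]]]|[[e0 [e1 [e2 e3]]]|
    [[e0 [e1 [e2 e3]]]|[e0 [e1 [e2 e3]]]]]]].
  + by apply: (fin 4 1 (1, 0, 4)); rewrite ?e0 //; [case=> [|[|[|[|u]]]]|left].
  + by apply: (fin 3 1 (2, 1, 3)); rewrite ?e0 //; [case=> [|[|[|u]]]|right].
  + by apply: (fin 2 2 (2, 0, 2)); rewrite ?e0 //; [case=> [|[|u]]|right].
  + by apply: (fin 2 1 (3, 2, 2)); rewrite ?e0 //; [case=> [|[|u]]|right].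
  + by apply: (fin 1 4 (4, 0, 1)); rewrite ?e0 //; [case=> [|[|u]]|right].
Qed.

End Shapes.

(** * The second, third and fourth symbolic powers *)

Lemma binz_pascal s c : 0 < c ->
  binz s.+1 (c%:Z - 1)%R = binz s (c%:Z - 1)%R + binz s (c%:Z - 2)%R.
Proof. by case: c => [|[|c]] // _; rewrite /= !subSS !subn0 ?bin0 ?binS. Qed.

Section SmallPowers.
Variables (k : fieldType) (n s c : nat) (F : 'I_s -> {mpoly k[n.+1]}).
Hypothesis c_gt0 : 1 <= c.
Hypothesis lt_cs : c < s.
Hypothesis hform : forall i, exists d : nat, F i \is d.-homog.
Hypothesis hreg : forall j : 'I_c.+1 -> 'I_s, injective j ->
  regular_seq (fun i => F (j i)).

(** The constant coefficient is the residue map used to count generators: a form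
    with a nonzero constant coefficient has degree 0 and is a unit, which no member
    of a regular sequence is. *)
Lemma form_mcoeff0 i : mcoeff 0%MM (F i) = 0%R.
Proof.
apply: contrapT => /eqP F0; have [d /dhomogP hd] := hform i.
have d0 : d = 0 by rewrite -(hd 0%MM) ?mcoeff_msupp //= mdeg0.
apply: (regular_nonunit lt_cs hreg (i := i)).
have eF : F i = (((F i)@_0%MM)%:MP)%R.
  apply: msize1_polyC; rewrite msizeE; apply/bigmax_leqP_seq => m /hd /= -> _.
  by rewrite d0.
exists (((F i)@_0%MM)^-1%:MP)%R; rewrite [in X in (_ * X)%R]eF -mpolyCM GRing.mulVf //.
Qed.

Lemma small_mu m : 1 < m < 5 ->
  mu_is (symbolic_pow (star_ideal c F) m)
    (binz s (c%:Z - 1)%R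
     + \sum_(x <- lower_shapes m) binz s (c%:Z - x.1.1%:Z)%R * 'C(s - c + x.1.1, x.1.2)) /\
  sdefect_is (star_ideal c F) m
    (\sum_(x <- lower_shapes m) binz s (c%:Z - x.1.1%:Z)%R * 'C(s - c + x.1.1, x.1.2)).
Proof.
move=> m25; have m0 : 0 < m by case/andP: m25; lia.
pose rest := [seq x : shape <- lower_shapes m | x.1.1 <= c].
have adm_lower x : x \in lower_shapes m -> x.1.1 <= c -> admissible c m x /\ x.2 < m.
  move: m25; case: m {m0 rest} => [|[|[|[|[|m]]]]] // _; rewrite !inE.
  - by move/eqP=> -> /= ->.
  - by case/orP=> /eqP -> /= ->.
  - by case/or4P=> /eqP -> /= ->.
have adm : all (admissible c m) ((1, 0, m) :: rest).
  apply/allP => x; rewrite inE => /orP[/eqP->|]; first by rewrite /= c_gt0 m0 /=; lia.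
  by rewrite mem_filter => /andP[xc xl]; case: (adm_lower x xl xc).
have uni : uniq (shapes_exps s c ((1, 0, m) :: rest)).
  apply: (shapes_exps_uniq c_gt0 lt_cs adm).
  have sub : subseq ((1, 0, m) :: rest) ((1, 0, m) :: lower_shapes m).
    by rewrite /= eqxx filter_subseq.
  apply: (subseq_uniq (map_subseq _ sub)).
  by move: m25; case: (m) => [|[|[|[|[|?]]]]].
have cplt a : a \in shapes_exps s c ((1, 0, m) :: rest) <-> minimal c m a.
  split=> [/flatten_mapP[x xl]|ma].
    exact: (shape_minimal c_gt0 lt_cs (allP adm x xl)).
  have [x xl [xc ax]] := small_minimal_shape c_gt0 lt_cs m25 ma.
  apply/flatten_mapP; exists x => //; move: xl; rewrite !inE => /orP[->//|xl].
  by rewrite mem_filter xc xl orbT.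
have in_first a : a \in shape_exps s c (1, 0, m) -> exists i, m <= a i.
  move=> a1; have pk : peak a = m.
    by apply: (shape_peak c_gt0 lt_cs _ a1); apply: (allP adm); rewrite inE eqxx.
  have I0 : 0 < #|'I_s| by rewrite card_ord (leq_ltn_trans (leq0n c)).
  by have [i ei] := bigop.eq_bigmax (fun i => a i) I0; exists i; rewrite -pk /peak ei.
have in_rest a : a \in shapes_exps s c rest -> forall i, a i < m.
  move=> /flatten_mapP[x xl ax] i; have xm := allP adm x.
  rewrite inE xl orbT in xm; apply: leq_ltn_trans (leq_bigmax _) _.
  rewrite -/(peak a) (shape_peak c_gt0 lt_cs (xm isT) ax).
  by move: xl; rewrite mem_filter => /andP[xc xl]; case: (adm_lower x xl xc).
have sizeE x : x.1.1 <= c ->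
    size (shape_exps s c x) = binz s (c%:Z - x.1.1%:Z)%R * 'C(s - c + x.1.1, x.1.2).
  by move=> xc; rewrite (size_shape_exps c_gt0 lt_cs) // subzn.
have size_rest : size (shapes_exps s c rest)
    = \sum_(x <- lower_shapes m) binz s (c%:Z - x.1.1%:Z)%R * 'C(s - c + x.1.1, x.1.2).
  rewrite size_flatten /shape sumnE !big_map big_filter.
  rewrite [RHS](bigID (fun x => x.1.1 <= c)) /=.
  rewrite [X in _ + X]big1 ?addn0 => [|x]; first by apply: eq_bigr => x /sizeE.
  by rewrite -ltnNge => cx; have -> : (c%:Z - x.1.1%:Z)%R = Negz (x.1.1 - c).-1 by lia.
have := @star_mu _ s c F c_gt0 lt_cs (@mpoly_noetherian k n.+1) _ _ k
  (mcoeff 0%MM) form_mcoeff0 m (shape_exps s c (1, 0, m)) (shapes_exps s c rest) m0 uni cplt.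
rewrite size_rest sizeE //= bin0 muln1.
apply=> //.
- by move=> A cA; apply: (regular_quasi_regular lt_cs hreg); rewrite cA.
- by move=> A i cA; apply: (regular_nonzerodiv lt_cs hreg); rewrite cA.
Qed.

End SmallPowers.

Theorem corollary4p19 (k : fieldType) (n s c : nat) (hc : 1 <= c) (hcs : c < s)
    (F : 'I_s -> {mpoly k[n.+1]})
    (hform : forall i, exists d : nat, F i \is d.-homog)
    (hreg : forall j : 'I_c.+1 -> 'I_s, injective j ->
       regular_seq (fun i => F (j i))) :
  let I := star_ideal c F in
  [/\ (mu_is (symbolic_pow I 2) (binz s.+1 (c%:Z - 1)%R)
       /\ sdefect_is I 2 (binz s (c%:Z - 2)%R)),
      (mu_is (symbolic_pow I 3)
         (binz s (c%:Z - 1)%R + (s - c + 2) * binz s (c%:Z - 2)%R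
          + binz s (c%:Z - 3)%R)
       /\ sdefect_is I 3
         ((s - c + 2) * binz s (c%:Z - 2)%R + binz s (c%:Z - 3)%R))
    & (mu_is (symbolic_pow I 4)
         (binz s (c%:Z - 1)%R + binz s (c%:Z - 2)%R * (s - c + 3)
          + binz s (c%:Z - 3)%R * 'C(s - c + 3, 2) + binz s (c%:Z - 4)%R)
       /\ sdefect_is I 4
         (binz s (c%:Z - 2)%R * (s - c + 3)
          + binz s (c%:Z - 3)%R * 'C(s - c + 3, 2) + binz s (c%:Z - 4)%R))].
Proof.
have small m := @small_mu k n s c F hc hcs hform hreg m.
rewrite !natz; split.
- have := small 2 isT; rewrite /= big_seq1 /= bin0 muln1 -binz_pascal //.
- have := small 3 isT; rewrite /= big_cons big_seq1 /= bin1 bin0 muln1.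
  by rewrite addnA ![binz s (c%:Z - 2%:Z)%R * _]mulnC.
- have := small 4 isT; rewrite /= !big_cons big_nil /= bin1 !bin0 !muln1 addn0.
  have -> : binz s (c%:Z - 2%:Z)%R * (s - c + 3)
      = binz s (c%:Z - 2%:Z)%R * (s - c + 2) + binz s (c%:Z - 2%:Z)%R.
    by rewrite -mulnSr addnS.
  by rewrite !addnA.
Qed.
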